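(* Let $z_1,z_2,\dots$ be i.i.d. standard normal random variables, let $I_1\ge 1$ and $I_2\ge 2$ be integers, and set $N_1=I_1$, $N_2=I_1+I_2$. Let $0<r_1<r_2$ and define the events $\zeta_1=\{\sum_{j=1}^{N_1} z_j^2>r_1^2\}$ and $\zeta_2=\{\sum_{j=1}^{N_2} z_j^2>r_2^2\}$. Let $p=\Pr(\chi^2_{I_1}>r_2^2)$, $$K=\frac{e^{-\frac12(r_2^2-I_2)}}{2^{N_1/2}\sqrt{\pi}\,I_2^{(I_2-1)/2}\,\Gamma(N_1/2)},\qquad g(t)=\frac{t^{N_1/2-1}(r_2^2-t)^{I_2/2}}{r_2^2-I_2+2-t},$$ $\underline{\delta}=(I_2-2)/r_2^2$ and $\overline{\delta}=(r_2^2-r_1^2)/r_2^2$. Then $$p+\frac{\sqrt{\pi}K}{2}\int_{r_1^2}^{r_2^2}(r_2^2-t)^{I_2/2-1}t^{I_1/2-1}\,dt\ \le\ \Pr(\zeta_1\cap\zeta_2)$$ and $$\Pr(\zeta_1\cap\zeta_2)\le p+\inf_{\delta\in(\underline{\delta},\overline{\delta})}\left[K\int_{r_1^2}^{(1-\delta)r_2^2}g(t)\,dt+\int_{(1-\delta)r_2^2}^{r_2^2}f_{\chi^2_{I_1}}(t)\,dt\right].$$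
   Context: For a positive integer $k$, $\chi^2_k$ denotes a random variable with the central chi-square distribution with $k$ degrees of freedom, and $f_{\chi^2_k}$ denotes its probability density function. $\Gamma$ is the Gamma function. *)

(* Defs.v *)
From HB Require Import structures.
From mathcomp Require Import all_boot all_order all_algebra.
From mathcomp Require Import all_classical all_reals all_analysis.
Set Implicit Arguments. Unset Strict Implicit. Unset Printing Implicit Defensive.
Import Order.TTheory GRing.Theory Num.Theory.
Local Open Scope classical_set_scope.
Local Open Scope ring_scope.

Definition Gamma {R : realType} (x : R) : R :=
  fine (\int[@lebesgue_measure R]_(t in `]0%R, +oo[) (powR t (x - 1) * expR (- t))%:E)%E.

Definition chisq_pdf {R : realType} (k : nat) (t : R) : R :=
  if 0 < t then
    powR t (k%:R / 2 - 1) * expR (- t / 2) / (powR 2 (k%:R / 2) * Gamma (k%:R / 2))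
  else 0.

Definition iid_std_normal d (T : measurableType d) (R : realType)
    (P : probability T R) (z : nat -> {RV P >-> R}) : Prop :=
  (forall (j : nat) (A : set R), measurable A ->
     P (z j @^-1` A) = normal_prob 0 1 A) /\
  (forall (S : seq nat) (B : nat -> set R), uniq S ->
     (forall j, j \in S -> measurable (B j)) ->
     P (\bigcap_(j in [set j | j \in S]) (z j @^-1` B j)) =
     (\prod_(j <- S) P (z j @^-1` B j))%E).

(* Main.v *)
Require Import Defs.
From HB Require Import structures.
From mathcomp Require Import all_boot all_order all_algebra.
From mathcomp Require Import all_classical all_reals all_analysis.
From mathcomp Require Import measurable_realfun ring lra.
Import Order.TTheory GRing.Theory Num.Theory.
Import numFieldNormedType.Exports.
Local Open Scope classical_set_scope.
Local Open Scope ring_scope.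
Set Implicit Arguments.
Unset Strict Implicit.
Unset Printing Implicit Defensive.

(* With X and Y the sums of the first I1 and of the next I2 squares, X and Y are
   independent chi-square variables and
     Pr(zeta1 /\ zeta2) = p + int_{r1^2}^{r2^2} f(t) Pr(Y > r2^2 - t) dt,
   where f is the density of X. For k >= 2 and u >= 0, monotonicity of
   y^(k/2-1) bounds Pr(chi2_k > u) from below by 2 u^(k/2-1) e^(-u/2) / W, with
   W = 2^(k/2) Gamma(k/2); for u > k - 2, the estimate
   (y/u)^(k/2-1) <= e^((k/2-1)(y/u-1)) bounds it from above by u / (u-k+2) times
   the same quantity. The normalizing constant W is then replaced by its Stirling
   approximation: W e^(k/2) / k^((k-1)/2) lies between 2 sqrt(pi) and 4. It
   decreases along k -> k+2 by a summable amount on the logarithmic scale, and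
   the duplication formula identifies its limit. On [(1-delta) r2^2, r2^2] the
   upper bound uses Pr(Y > r2^2 - t) <= 1 only. *)

(** * Stirling bounds *)

(** The recursion W(k+2) = k W(k) never compares an even index with an odd one, so the decreasing
    sequences along the two parities could a priori have different limits. The duplication formula
    relates n, n+1 and 2n; for odd n the last two have the same parity, so their terms cancel up to
    O(1/n) and a bound at n alone remains. Even n are then reached through W(n+1)^2 <= n W(n)^2. No
    limit is taken: every value dominates the later ones of its parity, and the value at n is at
    least ln (2 sqrt pi) - 1/n. The Stirling argument sees W through four properties only, all of
    them facts about the moments of e^(-x^2/2) on the half-line; [Gamma] enters only as another
    expression of W. The ends of the Stirling interval produce the constants of the theorem: 2/W is
    at least 2/4 = 1/2 times e^(k/2) / k^((k-1)/2), hence sqrt(pi) K / 2 in the lower bound, and at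
    most 2/(2 sqrt pi) = 1/sqrt(pi) times it, hence K in the upper one. *)

Lemma ge0_is_derive_le {R : realType} (f f' : R -> R) (x : R) : 0 <= x ->
  (forall y : R, 0 <= y -> is_derive y (1 : R) f (f' y)) ->
  (forall y : R, 0 <= y -> 0 <= f' y) -> f 0 <= f x.
Proof.
move=> x0 df f'0.
have cf : {within `[0, x], continuous f}.
  apply: derivable_within_continuous => y; rewrite in_itv/= => /andP[y0 _].
  by case: (df y y0).
have [|c] := @MVT_segment R f f' _ _ x0 _ cf.
  by move=> y; rewrite in_itv/= => /andP[/ltW y0 _]; exact: df.
rewrite in_itv/= => /andP[c0 _] /eqP.
rewrite subr_eq => /eqP ->; rewrite lerDr mulr_ge0 ?f'0//; lra.
Qed.

(** This bound and [ln1D_le] agree with ln (1 + x) to second order at 0. At x = 2/n the error is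
    O(n^-3), which stays summable after multiplication by (n+1)/2; the cruder upper bound x would
    leave terms of order 1/n. *)
Lemma ln1D_ge {R : realType} (x : R) : 0 <= x -> 2 * x / (2 + x) <= ln (1 + x).
Proof.
move=> x0.
pose f (y : R) := ln (1 + y) - 2 * y / (2 + y).
suff : f 0 <= f x by rewrite /f addr0 ln1 mulr0 mul0r subrr subr_ge0.
apply: (@ge0_is_derive_le _ f
  (fun y => (1 + y)^-1 - 4 / (2 + y) ^+ 2)) => // y y0.
  have l : is_derive (1 + y : R) (1 : R) (@ln R) (1 + y)^-1 by apply: is_derive1_ln; lra.
  have h : 2 + y != 0 by lra.
  rewrite /f; apply: is_derive_eq.
  rewrite /GRing.scale/= ; field; apply/andP; split; lra.
have -> : (1 + y)^-1 - 4 / (2 + y) ^+ 2 = y ^+ 2 / ((1 + y) * (2 + y) ^+ 2).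
  by field; apply/andP; split; lra.
by rewrite divr_ge0 ?sqr_ge0// mulr_ge0 ?sqr_ge0//; lra.
Qed.

Lemma ln1D_le {R : realType} (x : R) : 0 <= x -> ln (1 + x) <= (x + x / (1 + x)) / 2.
Proof.
move=> x0.
pose f (y : R) := (y + y / (1 + y)) / 2 - ln (1 + y).
suff : f 0 <= f x by rewrite /f addr0 ln1 mul0r add0r mul0r subrr subr_ge0.
apply: (@ge0_is_derive_le _ f
  (fun y => (y / (1 + y)) ^+ 2 / 2)) => // y y0.
  have l : is_derive (1 + y : R) (1 : R) (@ln R) (1 + y)^-1 by apply: is_derive1_ln; lra.
  have h : 1 + y != 0 by lra.
  rewrite /f; apply: is_derive_eq.
  rewrite /GRing.scale/= ; field; lra.
by rewrite divr_ge0 ?sqr_ge0.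
Qed.

Lemma nat_ind2 (Q : nat -> Prop) : Q 1%N -> Q 2%N ->
  (forall n, (1 <= n)%N -> Q n -> Q n.+2) -> forall n, (1 <= n)%N -> Q n.
Proof.
move=> Q1 Q2 QS n n1.
suff : Q n /\ Q n.+1 by case.
elim: n n1 => // -[_ _|n IHn _]; first by split.
by have [//|Qn Qn1] := IHn; split => //; exact: QS.
Qed.

(* The properties of [W n = 2^(n/2) Gamma(n/2)] used in the proof of Stirling's bounds. *)
Definition chi2_norm_seq {R : realType} (W : nat -> R) : Prop :=
  [/\ W 1%N = Num.sqrt (2 * pi), W 2%N = 2,
      forall n, (1 <= n)%N -> W n.+2 = n%:R * W n
    & forall n, (1 <= n)%N -> W n.+1 ^+ 2 <= n%:R * W n ^+ 2].

Lemma chi2_norm_seq_gt0 {R : realType} (W : nat -> R) : chi2_norm_seq W ->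
  forall n, (1 <= n)%N -> 0 < W n.
Proof.
case=> W1 W2 WS _; apply: nat_ind2; rewrite ?W1 ?W2//.
  by rewrite sqrtr_gt0 mulr_gt0// pi_gt0.
by move=> n n1 Wn; rewrite WS// mulr_gt0// ltr0n.
Qed.

(* The logarithm of [W n / (n^((n-1)/2) e^(-n/2))], the quantity which Stirling's
   formula says tends to [ln (2 sqrt pi)]. *)
Definition stirling_log {R : realType} (W : nat -> R) (n : nat) : R :=
  ln (W n) + n%:R / 2 - (n%:R - 1) / 2 * ln n%:R.

Section stirling.
Context {R : realType}.
Implicit Types (W : nat -> R) (n k : nat).

Lemma ln_natD n (x : R) : (1 <= n)%N -> 0 <= x ->
  ln (n%:R + x) = ln n%:R + ln (1 + x / n%:R).
Proof.
move=> n1 x0; have n0 : 0 < n%:R :> R by rewrite ltr0n.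
rewrite -lnM ?posrE//; first by congr ln; field; lra.
by rewrite ltr_pwDl// divr_ge0// ltW.
Qed.

(** The increment is 1 - (n+1)/2 ln (1 + 2/n). The lower bound on the logarithm is exactly 2/(n+1),
    which makes the increment nonpositive; the upper bound is 1/n + 1/(n+2), which leaves a
    telescoping difference. *)
Lemma stirling_logS2 W n : chi2_norm_seq W -> (1 <= n)%N ->
  stirling_log W n - (n%:R^-1 - n.+2%:R^-1) / 2 <= stirling_log W n.+2
    <= stirling_log W n.
Proof.
move=> hW n1; have Wn := chi2_norm_seq_gt0 hW n1.
case: hW => _ _ WS _.
have n0 : 1 <= n%:R :> R by rewrite ler1n.
have -> : stirling_log W n.+2 = stirling_log W n + 1 -
    (n%:R + 1) / 2 * ln (1 + 2 / n%:R).
  rewrite /stirling_log WS// lnM ?posrE//; last lra.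
  by rewrite -[n.+2]addn2 natrD ln_natD//; field; lra.
have x0 : 0 <= 2 / n%:R :> R by rewrite divr_ge0//; lra.
have := ln1D_ge x0; have := ln1D_le x0.
rewrite -[n.+2]addn2 natrD.
have -> : (2 / n%:R + 2 / n%:R / (1 + 2 / n%:R)) / 2 = n%:R^-1 + (n%:R + 2)^-1 :> R.
  by field; apply/andP; split; lra.
have -> : 2 * (2 / n%:R) / (2 + 2 / n%:R) = 2 / (n%:R + 1) :> R.
  by field; apply/andP; split; lra.
set l := ln _ => le ge.
have h1 : (n%:R + 1) / 2 * l <= (n%:R + 1) / 2 * (n%:R^-1 + (n%:R + 2)^-1).
  by apply: ler_wpM2l => //; lra.
have h2 : (n%:R + 1) / 2 * (2 / (n%:R + 1)) <= (n%:R + 1) / 2 * l.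
  by apply: ler_wpM2l => //; lra.
have e1 : (n%:R + 1) / 2 * (2 / (n%:R + 1)) = 1 :> R by field; lra.
have e2 : (n%:R + 1) / 2 * (n%:R^-1 + (n%:R + 2)^-1) =
   1 + (n%:R^-1 - (n%:R + 2)^-1) / 2 :> R.
  by field; apply/andP; split; lra.
rewrite e1 in h2; rewrite e2 in h1.
by apply/andP; split; lra.
Qed.

Lemma stirling_log_le W n k : chi2_norm_seq W -> (1 <= n)%N ->
  stirling_log W (n + k.*2) <= stirling_log W n.
Proof.
move=> hW n1; elim: k => [|k IHk]; first by rewrite addn0.
rewrite doubleS !addnS; apply: le_trans IHk.
by have /andP[_ +] := stirling_logS2 hW (leq_trans n1 (leq_addr k.*2 n)).
Qed.

Lemma stirling_log_ge W n k : chi2_norm_seq W -> (1 <= n)%N ->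
  stirling_log W n - n%:R^-1 / 2 <= stirling_log W (n + k.*2).
Proof.
move=> hW n1.
suff h : stirling_log W n - (n%:R^-1 - (n + k.*2)%:R^-1) / 2
    <= stirling_log W (n + k.*2).
  apply: le_trans h; have : 0 <= (n + k.*2)%:R^-1 :> R by rewrite invr_ge0.
  by set x := (n + k.*2)%:R^-1; lra.
elim: k => [|k IHk]; first by rewrite addn0 subrr mul0r subr0.
rewrite doubleS !addnS.
have /andP[+ _] := stirling_logS2 hW (leq_trans n1 (leq_addr k.*2 n)).
move: IHk; set x := (n + k.*2)%:R^-1; set y := (n + k.*2).+2%:R^-1.
by lra.
Qed.

(** Passing from n to n+1 multiplies the left-hand side by 2n, since W n becomes W (n+2) = n W n and
    the power of 2 doubles; this is also the factor W (2n+2) / W (2n) on the right. *)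
Lemma chi2_norm_seq_duplication W n : chi2_norm_seq W -> (1 <= n)%N ->
  W n * W n.+1 * 2 ^+ n = 2 * Num.sqrt (2 * pi) * W n.*2.
Proof.
case=> W1 W2 WS _; elim: n => // -[_ _|n IHn _].
  by rewrite W1 W2 expr1; ring.
rewrite (WS n.+1)// (doubleS n.+1) (WS n.+1.*2)// [_ ^+ n.+2]exprS.
have := IHn isT.
set a := W n.+1; set b := W n.+2; set c := 2 ^+ n.+1; set s := Num.sqrt _.
set e := W _ => h; rewrite -[n.+1.*2]mul2n natrM.
have -> : b * (n.+1%:R * a) * (2 * c) = (2 * n.+1%:R) * (a * b * c) by ring.
by rewrite h; ring.
Qed.

(* Legendre's duplication formula: the left-hand side is [ln (2 sqrt pi)]
   up to a term that vanishes at infinity. *)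
Lemma stirling_log_duplication W n : chi2_norm_seq W -> (1 <= n)%N ->
  stirling_log W n + stirling_log W n.+1 - stirling_log W n.*2 =
  ln (2 * Num.sqrt pi) + (1 - n%:R * ln (1 + n%:R^-1)) / 2.
Proof.
move=> hW n1; have n0 : 1 <= n%:R :> R by rewrite ler1n.
have Wgt0 := chi2_norm_seq_gt0 hW.
have := congr1 (@ln R) (chi2_norm_seq_duplication hW n1).
have sp : 0 < Num.sqrt pi :> R by rewrite sqrtr_gt0 pi_gt0.
have s2 : 0 < Num.sqrt 2 :> R by rewrite sqrtr_gt0.
have Wn2 : 0 < W n.*2 by rewrite Wgt0// double_gt0.
rewrite sqrtrM// !lnM ?posrE ?mulr_gt0 ?exprn_gt0 ?Wgt0//.
rewrite lnXn// -powR12_sqrt// ln_powR -[ln 2 *+ n]mulr_natr /stirling_log => e.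
rewrite -[n.+1%:R]natr1 ln_natD// div1r.
rewrite -[in n.*2%:R]mul2n natrM lnM ?posrE ?ltr0n ?double_gt0//.
move: e; set lW2 := ln (W n.*2); set lp := ln (Num.sqrt pi).
set l2 := ln 2; set ln' := ln n%:R; set l1 := ln (1 + _).
set a := ln (W n); set b := ln (W n.+1) => e.
have -> : a = l2 + (2^-1 * l2 + lp) + lW2 - b - l2 * n%:R.
  rewrite -e; ring.
by field; lra.
by rewrite double_gt0.
Qed.

(** Controls the vanishing term of the duplication identity; the upper bound comes from n ln (1 +
    1/n) >= 1 - 1/(2n+1). *)
Lemma ln1DV_bounds n : (1 <= n)%N ->
  0 <= (1 - n%:R * ln (1 + (n%:R : R)^-1)) / 2 <= n%:R^-1 / 2.
Proof.
move=> n1; have n0 : 1 <= n%:R :> R by rewrite ler1n.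
have v0 : 0 <= n%:R^-1 :> R by rewrite invr_ge0; lra.
have v1 : n%:R * n%:R^-1 = 1 :> R by rewrite mulfV//; lra.
have le : ln (1 + n%:R^-1) <= n%:R^-1 :> R by apply: le_ln1Dx; lra.
have ge := ln1D_ge v0.
have h1 : n%:R * ln (1 + n%:R^-1) <= n%:R * n%:R^-1 :> R.
  by apply: ler_wpM2l => //; lra.
have h2 : n%:R * (2 * n%:R^-1 / (2 + n%:R^-1)) <= n%:R * ln (1 + n%:R^-1) :> R.
  by apply: ler_wpM2l => //; lra.
have e2 : n%:R * (2 * n%:R^-1 / (2 + n%:R^-1)) = 1 - (2 * n%:R + 1)^-1 :> R.
  by field; do ?[apply/andP; split]; lra.
have h3 : (2 * n%:R + 1)^-1 <= n%:R^-1 :> R.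
  by rewrite lef_pV2 ?posrE; lra.
rewrite e2 in h2; rewrite v1 in h1.
set x := n%:R * ln _ in h1 h2 *; set y := (_ + 1)^-1 in h2 h3 *.
by apply/andP; split; lra.
Qed.

Lemma stirling_log_odd_ge W n : chi2_norm_seq W -> odd n ->
  ln (2 * Num.sqrt pi) - n%:R^-1 / 2 <= stirling_log W n.
Proof.
move=> hW on; have n1 := odd_gt0 on.
have /andP[f0 f1] := ln1DV_bounds n1.
have := stirling_log_duplication hW n1.
(* For odd n the indices 2n and n+1 differ by the even number n-1, so [stirling_log_ge] compares
   them. *)
have -> : n.*2 = (n.+1 + (n./2).*2)%N.
  by have := odd_double_half n; rewrite on -[in n.*2]addnn => {2}<-; rewrite addnA addn1.
have := stirling_log_ge (n./2) hW (ltn0Sn n).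
have : n.+1%:R^-1 <= n%:R^-1 :> R.
  by rewrite lef_pV2 ?posrE ?ltr0n// ler_nat.
move: f0 f1; set e := (1 - _) / 2.
set D1 := stirling_log W n.+1; set D2 := stirling_log W (_ + _).
set x := n.+1%:R^-1; set y := n%:R^-1.
by lra.
Qed.

(** For even n, the inequality W (n+1)^2 <= n W n^2 gives [stirling_log W n.+1] <=
    [stirling_log W n] + e, where e is again the vanishing term of the duplication identity; the odd
    case at n+1 then applies. *)
Lemma stirling_log_ge_eps W n : chi2_norm_seq W -> (1 <= n)%N ->
  ln (2 * Num.sqrt pi) - n%:R^-1 <= stirling_log W n.
Proof.
move=> hW n1; have /andP[e0 e1] := ln1DV_bounds n1.
have v0 : 0 <= n%:R^-1 :> R by rewrite invr_ge0.
have [on|en] := boolP (odd n).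
  by have := stirling_log_odd_ge hW on; set y := n%:R^-1 in v0 *; lra.
have := @stirling_log_odd_ge W n.+1 hW en.
have : n.+1%:R^-1 <= n%:R^-1 :> R.
  by rewrite lef_pV2 ?posrE ?ltr0n// ler_nat.
case: (hW) => _ _ _ /(_ _ n1) c.
have Wgt0 := chi2_norm_seq_gt0 hW.
have n0 : 0 < n%:R :> R by rewrite ltr0n.
have {c} : ln (W n.+1) * 2 <= ln n%:R + ln (W n) * 2.
  rewrite !mulr_natr -!lnXn ?Wgt0// -lnM ?posrE ?exprn_gt0 ?Wgt0//.
  by rewrite ler_ln ?posrE ?mulr_gt0 ?exprn_gt0 ?Wgt0.
have -> : stirling_log W n.+1 = ln (W n.+1) - ln (W n) - ln n%:R / 2 +
    stirling_log W n + (1 - n%:R * ln (1 + n%:R^-1)) / 2.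
  rewrite /stirling_log -[n.+1%:R]natr1 ln_natD// div1r; field; lra.
set e := (1 - _) / 2 in e0 e1 *.
set x := n.+1%:R^-1; set y := n%:R^-1 in e1 *.
by lra.
Qed.

Lemma stirling_log_ge0 W n : chi2_norm_seq W -> (1 <= n)%N ->
  ln (2 * Num.sqrt pi) <= stirling_log W n.
Proof.
move=> hW n1; apply/ler_addgt0Pl => e e0.
have [k ke] : exists k : nat, e^-1 < k%:R.
  by exists (Num.bound e^-1); rewrite archi_boundP// invr_ge0 ltW.
have k0 : 0 < k%:R :> R by rewrite (lt_trans _ ke)// invr_gt0.
have nk1 : (1 <= n + k.*2)%N by rewrite (leq_trans n1)// leq_addr.
have := stirling_log_le k hW n1.
have := stirling_log_ge_eps hW nk1.
have : (n + k.*2)%:R^-1 <= e.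
  rewrite -[e]invrK lef_pV2 ?posrE ?ltr0n ?invr_gt0//.
  rewrite (le_trans (ltW ke))// ler_nat -addnn addnA.
  by rewrite leq_addl.
set x := _%:R^-1; lra.
Qed.

(** Decrease along each parity reduces the claim to n = 2, where it amounts to ln 2 >= 2/3, and n =
    3. It fails at n = 1, where exponentiating gives sqrt (2 pi e) > 4. *)
Lemma stirling_log_le_ln4 W n : chi2_norm_seq W -> (2 <= n)%N ->
  stirling_log W n <= ln 4.
Proof.
move=> hW n2; have Wgt0 := chi2_norm_seq_gt0 hW.
have ln_ge (x y a : R) : 0 <= x -> 1 + x = y -> 2 * x = a * (2 + x) -> a <= ln y.
  move=> x0 <- e; apply: le_trans (ln1D_ge x0).
  by rewrite ler_pdivlMr ?e//; lra.
have l2 : 2 / 3 <= ln 2 :> R by apply: (@ln_ge 1); lra.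
have l43 : 2 / 7 <= ln (4 / 3) :> R by apply: (@ln_ge (1 / 3)); lra.
have l32 : 2 / 5 <= ln (3 / 2) :> R by apply: (@ln_ge (1 / 2)); lra.
have l54 : 2 / 9 <= ln (5 / 4) :> R by apply: (@ln_ge (1 / 4)); lra.
have l4 : ln 4 = ln 2 * 2 :> R by rewrite mulr_natr -lnXn//; congr ln; ring.
rewrite !ln_div ?posrE// in l43 l32 l54.
case: (hW) => W1 W2 WS c.
have D2 : stirling_log W 2 <= ln 4.
  by rewrite /stirling_log W2; lra.
have D3 : stirling_log W 3 <= ln 4.
  rewrite /stirling_log.
  (* A Wallis-type estimate in place of a numerical bound on pi = W 3^2 / 2: with W 7 = 15 W 3 and W
     6 = 16, the inequality W 7^2 <= 6 W 6^2 gives W 3^2 <= 512/75. *)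
  have := c 6 isT.
  rewrite (WS 5) // (WS 3)// (WS 4)// (WS 2)// W2 => h.
  have : ln (W 3 ^+ 2) <= ln (4 ^+ 4 * 2 / (5 ^+ 2 * 3)).
    rewrite ler_ln ?posrE ?exprn_gt0 ?Wgt0//.
    by set w := W 3 in h *; nra.
  have -> : ln (4 ^+ 4 * 2 / (5 ^+ 2 * 3)) = ln 4 * 4 + ln 2 - (ln 5 * 2 + ln 3) :> R.
    rewrite ln_div ?posrE// [ln (4 ^+ 4 * 2)]lnM ?posrE// [ln (5 ^+ 2 * 3)]lnM ?posrE//.
    by rewrite !lnXn// -[ln 4 *+ 4]mulr_natr -[ln 5 *+ 2]mulr_natr.
  by rewrite lnXn ?Wgt0// -[ln _ *+ 2]mulr_natr; lra.
rewrite -(subnKC n2); set k := (n - 2)%N.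
rewrite -(odd_double_half k) addnA.
apply: le_trans (stirling_log_le _ hW _) _ => //.
by case: (odd k).
Qed.

End stirling.

Lemma chi2_norm_seq_ge {R : realType} (W : nat -> R) n : chi2_norm_seq W -> (1 <= n)%N ->
  2 * Num.sqrt pi * (powR (n%:R : R) ((n%:R - 1) / 2) * expR (- n%:R / 2)) <= W n.
Proof.
move=> hW n1; have Wn := chi2_norm_seq_gt0 hW n1.
have n0 : 0 < n%:R :> R by rewrite ltr0n.
have sp : 0 < Num.sqrt pi :> R by rewrite sqrtr_gt0 pi_gt0.
have := stirling_log_ge0 hW n1; rewrite /stirling_log => h.
have p0 : 0 < powR (n%:R : R) ((n%:R - 1) / 2) by rewrite powR_gt0.
rewrite -ler_ln ?posrE ?mulr_gt0 ?expR_gt0//.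
rewrite [leLHS]lnM ?posrE ?mulr_gt0 ?expR_gt0//.
rewrite [ln (powR _ _ * _)]lnM ?posrE ?mulr_gt0 ?expR_gt0// expRK ln_powR; lra.
Qed.

Lemma chi2_norm_seq_le {R : realType} (W : nat -> R) n : chi2_norm_seq W -> (2 <= n)%N ->
  W n <= 4 * (powR (n%:R : R) ((n%:R - 1) / 2) * expR (- n%:R / 2)).
Proof.
move=> hW n2; have n1 := ltnW n2; have Wn := chi2_norm_seq_gt0 hW n1.
have n0 : 0 < n%:R :> R by rewrite ltr0n.
have := stirling_log_le_ln4 hW n2; rewrite /stirling_log => h.
have p0 : 0 < powR (n%:R : R) ((n%:R - 1) / 2) by rewrite powR_gt0.
rewrite -ler_ln ?posrE ?mulr_gt0 ?expR_gt0//.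
rewrite [leRHS]lnM ?posrE ?mulr_gt0 ?expR_gt0//.
rewrite [ln (powR _ _ * _)]lnM ?posrE ?mulr_gt0 ?expR_gt0// expRK ln_powR; lra.
Qed.

(** * Densities and changes of variables *)

Section density.
Local Open Scope ereal_scope.
Context d (T : measurableType d) (R : realType).
Variables (m : {measure set T -> \bar R}) (f : T -> R).
Hypotheses (f0 : forall x, (0 <= f x)%R) (mf : measurable_fun [set: T] f).

Lemma density_measure : exists nu : {measure set T -> \bar R},
  forall A, nu A = \int[m]_(x in A) (f x)%:E.
Proof.
pose nu A := \int[m]_(x in A) (f x)%:E.
have mEf : measurable_fun [set: T] (EFin \o f) by exact/measurable_EFinP.
have nu0 : nu set0 = 0 by rewrite /nu integral_set0.
have nu_ge0 A : 0 <= nu A by by apply: integral_ge0 => x _; rewrite lee_fin.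
have nuD : semi_sigma_additive nu.
  move=> /= F mF tF mUF; rewrite /nu; apply: cvg_toP.
    apply: ereal_nondecreasing_is_cvgn => k n kn.
    by apply: lee_sum_nneg_natr => // i _ _; by apply: integral_ge0 => x _; rewrite lee_fin.
  rewrite ge0_integral_bigcup//; first exact: measurable_funTS.
  by move=> x _; rewrite lee_fin.
pose mix := isMeasure.Build _ _ _ nu nu0 nu_ge0 nuD.
pose nu' : {measure set T -> \bar R} := HB.pack nu mix.
by exists nu'.
Qed.

Import HBNNSimple.

(** True for indicators by hypothesis, hence for simple functions by linearity, hence for [h] by
    monotone convergence along simple approximations. *)
Lemma ge0_integral_density (nu : {measure set T -> \bar R}) (h : T -> \bar R) :
  (forall A, measurable A -> nu A = \int[m]_(x in A) (f x)%:E) ->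
  (forall x, 0 <= h x) -> measurable_fun [set: T] h ->
  \int[nu]_x h x = \int[m]_x (h x * (f x)%:E).
Proof.
move=> nuE h0 mh; have mEf : measurable_fun [set: T] (EFin \o f) by exact/measurable_EFinP.
pose h_ := nnsfun_approx measurableT mh.
have ind A : measurable A -> \int[m]_x ((\1_A x)%:E * (f x)%:E) = nu A.
  move=> mA; rewrite nuE// [RHS]integral_mkcond; apply: eq_integral => x _.
  rewrite patchE indicE; case: ifP => xA; last by rewrite mul0e.
  by rewrite mul1e.
have simple (g : {nnsfun T >-> R}) :
    \int[nu]_x (g x)%:E = \int[m]_x ((g x)%:E * (f x)%:E).
  transitivity (\sum_(k \in range g) k%:E * nu (g @^-1` [set k])).
    by rewrite integralT_nnsfun sintegralE.
  transitivity (\int[m]_x (\sum_(k \in range g)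
      k%:E * ((\1_(g @^-1` [set k]) x)%:E * (f x)%:E))).
    rewrite ge0_integral_fsum//.
    - apply: eq_fsbigr => r /set_mem[t _ <-].
      rewrite ge0_integralZl ?ind//.
      + by apply: emeasurable_funM => //; exact/measurable_EFinP.
      + by move=> x _; rewrite mule_ge0 ?lee_fin.
      + by rewrite lee_fin.
    - move=> r; apply: emeasurable_funM => //; apply: emeasurable_funM => //.
      exact/measurable_EFinP.
    - move=> r x _; rewrite muleA mule_ge0 ?lee_fin//.
      exact: nnfun_muleindic_ge0.
  apply: eq_integral => x _.
  rewrite [in RHS]fimfunE -fsumEFin// ge0_mule_fsuml; last first.
    by move=> r; rewrite nnfun_muleindic_ge0.
  by apply: eq_fsbigr => r _; rewrite muleA EFinM.
transitivity (limn (fun n => \int[nu]_x (h_ n x)%:E)).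
  rewrite -monotone_convergence//=.
  - apply: eq_integral => x _; apply/esym/cvg_lim => //=.
    by apply: cvg_nnsfun_approx.
  - by move=> n; exact/measurable_EFinP.
  - by move=> n x _; rewrite lee_fin.
  - by move=> x _ a b ab; rewrite lee_fin//; exact/lefP/nd_nnsfun_approx.
under eq_fun do rewrite simple.
rewrite -monotone_convergence//=.
- apply: eq_integral => x _; apply/cvg_lim => //=.
  by apply: cvgeZr => //; exact: cvg_nnsfun_approx.
- by move=> n; apply: emeasurable_funM => //; exact/measurable_EFinP.
- by move=> n x _; rewrite mule_ge0 ?lee_fin.
- move=> x _ a b ab; apply: lee_wpmul2r; first by rewrite lee_fin.
  by rewrite lee_fin//; exact/lefP/nd_nnsfun_approx.
Qed.

End density.

(** Rectangles are stable under intersection and generate the product sigma-algebra, and the whole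
    space is one of them. *)
Lemma measure_unique_rectangle d1 d2 (T1 : measurableType d1) (T2 : measurableType d2)
    (R : realType) (m1 m2 : {measure set (T1 * T2) -> \bar R}) :
  (m1 setT < +oo)%E ->
  (forall A B, measurable A -> measurable B -> m1 (A `*` B) = m2 (A `*` B)) ->
  forall X, measurable X -> m1 X = m2 X.
Proof.
move=> m1oo m12 X mX.
pose C : set (set (T1 * T2)) :=
  [set C | exists A, measurable A /\ exists B, measurable B /\ C = A `*` B].
apply: (measure_unique C (fun=> setT)) => //.
- rewrite measurable_prod_measurableType //; congr (<<s _ >>).
  rewrite predeqE; split => [[A mA [B mB <-]]|[A [mA [B [mB ->]]]]].
    by exists A; split => //; exists B.
  by exists A => //; exists B.
- move=> /= _ _ [X1 [mX1 [X2 [mX2 ->]]]] [Y1 [mY1 [Y2 [mY2 ->]]]].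
  rewrite -setXI; exists (X1 `&` Y1); split; first exact: measurableI.
  by exists (X2 `&` Y2); split => //; exact: measurableI.
- by move=> _; exists setT; split => //; exists setT; rewrite setXTT.
- by rewrite bigcup_const//; exists 0%N.
- by move=> _ [A [mA [B [mB ->]]]]; exact: m12.
Qed.

Lemma pushforward_measure d1 d2 (X : measurableType d1) (Y : measurableType d2)
    (R : realType) (m : {measure set X -> \bar R}) (phi : X -> Y) :
  measurable_fun setT phi ->
  exists nu : {measure set Y -> \bar R}, (nu : set Y -> \bar R) = pushforward m phi.
Proof.
move=> mphi; unshelve eexists.
  by eapply (pushforward m phi : {measure set Y -> \bar R}).
Unshelve.
  by [].
exact: mphi.
Qed.

Section lebesgue_change_of_variables.
Local Open Scope ereal_scope.
Context {R : realType}.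
Notation mu := (@lebesgue_measure R).

(** The image of Lebesgue measure under x -> a x + b, multiplied by a, gives every interval ]x, y]
    its length, so it is Lebesgue measure. *)
Lemma ge0_integral_affine (F : R -> \bar R) (a b : R) : (0 < a)%R ->
  (forall x, 0 <= F x) -> measurable_fun setT F ->
  \int[mu]_x F x = a%:E * \int[mu]_x F (a * x + b)%R.
Proof.
move=> a0 F0 mF.
pose phi (x : R) : measurableTypeR R := (a * x + b)%R.
have mphi : measurable_fun setT phi.
  by apply: measurable_funD => //; exact: measurable_funM.
have [nu nuE] := pushforward_measure mu mphi.
transitivity (\int[mscale (NngNum (ltW a0)) nu]_x F x).
  apply: eq_measure_integral => A mA _.
  apply: lebesgue_measure_unique => // _ [[x y] _ <-].
  rewrite /= /mscale/= nuE /pushforward/=.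
  have -> : phi @^-1` `]x, y] = `]((x - b) / a)%R, ((y - b) / a)%R]%classic.
    apply/seteqP; split => t /=; rewrite !in_itv/= /phi ltr_pdivrMr// ler_pdivlMr//;
      by rewrite ltrBlDr lerBrDr mulrC.
  rewrite !lebesgue_measure_itv/= !lte_fin ltr_pM2r ?invr_gt0// ltrD2r.
  case: ifP => _; last by rewrite mule0.
  by rewrite -!EFinD -EFinM; congr EFin; field; lra.
rewrite ge0_integral_mscale//= nuE; congr (_ * _).
by rewrite ge0_integral_pushforward.
Qed.

Lemma ltr_sqrtl (a x : R) : (0 < x)%R -> (Num.sqrt a < x)%R = (a < x ^+ 2)%R.
Proof.
by move=> x0; rewrite -{1}[x](gtr0_norm x0) -sqrtr_sqr ltr_sqrt ?exprn_gt0.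
Qed.

Lemma integral_double_itv (a b : R) : (a < b)%R ->
  \int[mu]_(x in `]a, b]) (2 * x)%:E = (b ^+ 2 - a ^+ 2)%:E.
Proof.
move=> ab; rewrite integral_itv_obnd_cbnd; last first.
  by apply: measurable_funTS; apply/measurable_EFinP; exact: measurable_funM.
rewrite (@continuous_FTC2 _ (fun x => 2 * x)%R (fun x => x ^+ 2)%R)//.
- apply: continuous_subspaceT => x.
  by apply: cvgM; [exact: cvg_cst|exact: cvg_id].
- split.
  + by move=> x _; exact: exprn_derivable.
  + by apply: cvg_at_right_filter; exact: exprn_continuous.
  + by apply: cvg_at_left_filter; exact: exprn_continuous.
- by move=> x _; rewrite exp_derive1 expr1.
Qed.

Lemma integral_restrict_gt0 (G : R -> \bar R) :
  \int[mu]_(t in `]0%R, +oo[) G t = \int[mu]_t (if (0 < t)%R then G t else 0).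
Proof.
rewrite integral_mkcond; apply: eq_integral => t _.
by rewrite patchE mem_setE/= in_itv/= andbT.
Qed.

Lemma ge0_integral_sqr (F : R -> \bar R) :
  (forall x, 0 <= F x) -> measurable_fun setT F ->
  \int[mu]_(t in `]0%R, +oo[) F t =
  \int[mu]_(x in `]0%R, +oo[) (F (x ^+ 2)%R * (2 * x)%:E).
Proof.
move=> F0 mF.
pose f (x : R) : R := if (0 < x)%R then (2 * x)%R else 0%R.
have f0 x : (0 <= f x)%R by rewrite /f; case: ifPn => // /ltW; lra.
have mf : measurable_fun setT f.
  apply: measurable_fun_ifT => //; exact: measurable_fun_ltr.
pose sq (x : R) : measurableTypeR R := (x ^+ 2)%R.
have msq : measurable_fun setT sq by exact: measurable_funX.
have [nu1 nu1E] := density_measure mu f0 mf.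
have [nu2 nu2E] := pushforward_measure nu1 msq.
(* The image of [2x dx] is Lebesgue measure on the positive half-line; adding the
   negative half-line makes the uniqueness of Lebesgue measure applicable. *)
pose D : set R := `]-oo, 0%R]%classic.
have mD : measurable D by exact: measurable_itv.
have nuE A : measurable A -> mu A = measure_add nu2 (mrestr mu mD) A.
  move=> mA; apply: lebesgue_measure_unique => // _ [[a b] _ <-].
  rewrite [RHS](measure_addE nu2 (mrestr mu mD))/= nu2E /pushforward nu1E /mrestr.
  (* [Num.sqrt] is 0 on negative numbers, so no sign condition on a and b is required: only x > 0
     contributes to the left-hand side. *)
  have -> : \int[mu]_(x in sq @^-1` `]a, b]) (f x)%:E =
      \int[mu]_(x in `]Num.sqrt a, Num.sqrt b]) (2 * x)%:E.
    rewrite integral_mkcond [RHS]integral_mkcond; apply: eq_integral => x _.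
    rewrite !patchE !mem_setE /f /sq/= !in_itv/=.
    have [x0|x0] := ltP 0%R x.
      by rewrite ltr_sqrtl// [(x <= _)%R]leNgt ltr_sqrtl// -leNgt.
    rewrite [in RHS]ifF ?if_same//; apply/negbTE.
    by rewrite negb_and -leNgt (le_trans x0)// sqrtr_ge0.
  have -> : `](a, b).1, (a, b).2] `&` D = `]a, Num.min b 0%R]%classic.
    apply/seteqP; split => t /=; rewrite /D/= !in_itv/= le_min.
      by move=> [/andP[-> ->] ->].
    by move=> /and3P[-> -> ->].
  have empty (x y : R) g : (y <= x)%R -> \int[mu]_(x in `]x, y]) g x = 0.
    by move=> yx; rewrite set_itv_ge ?integral_set0// bnd_simp -leNgt.
  rewrite !lebesgue_measure_itv/= !lte_fin.
  have [b0|b0] := leP b 0%R.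
    by rewrite empty ?add0e// (ler0_sqrtr b0) sqrtr_ge0.
  rewrite -EFinB; have [a0|a0] := ltP a 0%R.
    rewrite (lt_trans a0 b0) integral_double_itv ?(ltr0_sqrtr a0) ?sqrtr_gt0//.
    by rewrite sqr_sqrtr ?(ltW b0)// expr0n subr0 -EFinB -EFinD sub0r.
  rewrite adde0; case: ltP => ab.
    by rewrite integral_double_itv ?ltr_sqrt// !sqr_sqrtr ?(ltW b0).
  by rewrite empty// ler_sqrt.
pose F' (t : R) : \bar R := if (0 < t)%R then F t else 0.
have F'0 t : 0 <= F' t by rewrite /F'; case: ifPn.
have mF' : measurable_fun setT F'.
  by apply: measurable_fun_ifT => //; exact: measurable_fun_ltr.
rewrite integral_restrict_gt0 [RHS]integral_restrict_gt0.
transitivity (\int[measure_add nu2 (mrestr mu mD)]_t F' t).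
  by apply: eq_measure_integral => A mA _; exact: nuE.
rewrite ge0_integral_measure_add// [X in _ + X](_ : _ = 0) ?adde0.
  rewrite nu2E ge0_integral_pushforward// preimage_setT.
  have E := ge0_integral_density (m := mu) f0 mf (nu := nu1) (h := F' \o sq).
  rewrite E//; first last.
    exact: measurableT_comp.
    by move=> x; exact: F'0.
  apply: eq_integral => x _; rewrite /= /F' /f /sq.
  have [x0|x0] := ltP 0%R x; first by rewrite exprn_gt0.
  by rewrite mule0.
have mD1 : measurable_fun setT (\1_D : R -> R) by exact: measurable_indic.
apply: etrans.
  apply: (ge0_integral_density (m := mu) (f := \1_D) _ mD1 (h := F')) => //.
  by move=> A mA; rewrite integral_indic//= /mrestr setIC.
apply: integral0_eq => x _; rewrite /F' indicE mem_setE/= in_itv/=.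
by case: ltP => x0; rewrite ?mul0e ?mule0.
Qed.

End lebesgue_change_of_variables.

(** * Normalizing constants of the chi-square densities *)

Section chi2_mass.
Local Open Scope ereal_scope.
Context {R : realType}.
Notation mu := (@lebesgue_measure R).

(** The substitution t = x^2 turns [chi2_mass n.+1] into twice [half_moment n], so half-integer
    powers of t become integer powers of x. *)
Definition half_moment (j : nat) : \bar R :=
  \int[mu]_(x in `]0%R, +oo[) (x ^+ j * expR (- x ^+ 2 / 2))%:E.

Lemma measurable_expR_sqr : measurable_fun setT (fun x : R => expR (- x ^+ 2 / 2)).
Proof.
apply: measurableT_comp => //; apply: measurable_funM => //.
by apply: measurableT_comp => //; exact: measurable_funX.
Qed.

Lemma measurable_half_moment j :
  measurable_fun setT (fun x : R => (x ^+ j * expR (- x ^+ 2 / 2))%:E).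
Proof.
apply/measurable_EFinP; apply: measurable_funM; first exact: measurable_funX.
exact: measurable_expR_sqr.
Qed.

Lemma integral_pow (j : nat) (x : R) : (0 < x)%R ->
  \int[mu]_(s in `]0%R, x[) (j.+1%:R * s ^+ j)%:E = (x ^+ j.+1)%:E.
Proof.
move=> x0; have mj : measurable_fun setT (fun s : R => (j.+1%:R * s ^+ j)%R%:E).
  by apply/measurable_EFinP; apply: measurable_funM => //; exact: measurable_funX.
rewrite integral_itv_bndo_bndc; last exact: measurable_funTS.
rewrite integral_itv_obnd_cbnd; last exact: measurable_funTS.
rewrite (@continuous_FTC2 _ (fun s => j.+1%:R * s ^+ j)%R (fun s => s ^+ j.+1)%R)//.
- by rewrite expr0n/= sube0.
- apply: continuous_subspaceT => s.
  by apply: cvgM; [exact: cvg_cst|exact: exprn_continuous].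
- split.
  + by move=> s _; exact: exprn_derivable.
  + by apply: cvg_at_right_filter; exact: exprn_continuous.
  + by apply: cvg_at_left_filter; exact: exprn_continuous.
- by move=> s _; rewrite exp_derive1.
Qed.

Lemma integral_gaussian_tail (s : R) : (0 <= s)%R ->
  \int[mu]_(x in `]s, +oo[) (x * expR (- x ^+ 2 / 2))%:E = (expR (- s ^+ 2 / 2))%:E.
Proof.
move=> s0; rewrite integral_itv_obnd_cbnd; last first.
  apply: measurable_funTS; have := measurable_half_moment 1.
  by under eq_fun do rewrite expr1.
have cF (x : R) : (fun x : R => expR (- x ^+ 2 / 2)) y @[y --> x] --> expR (- x ^+ 2 / 2).
  apply: continuous_comp; last exact: continuous_expR.
  apply: cvgM; last exact: cvg_cst.
  by apply: cvgN; exact: exprn_continuous.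
have dF (x : R) : is_derive (x : R) (1%R : R) (fun x : R => - expR (- x ^+ 2 / 2))%R
    (x * expR (- x ^+ 2 / 2))%R.
  apply: is_derive_eq; rewrite /GRing.scale/=.
  by field.
rewrite (@ge0_continuous_FTC2y _ _ (fun x => - expR (- x ^+ 2 / 2))%R _ 0%R).
- by rewrite EFinN oppeK add0e.
- by move=> x sx; rewrite mulr_ge0 ?expR_ge0// (le_trans s0).
- apply: continuous_subspaceT => x.
  by apply: cvgM; [exact: cvg_id|exact: cF].
- rewrite -oppr0; apply: cvgN.
  apply: (@squeeze_cvgr _ _ _ _ (fun=> 0%R)
    (fun x : R => expR (- (x / 2))%R)); last 2 first.
  + exact: cvg_cst.
  + apply: (@cvg_comp _ _ _ (fun x : R => (x / 2)%R) (fun x => expR (- x))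
      _ (pinfty_nbhs R)); last exact: cvgr_expR.
    by apply: gt0_cvgMly.
  near=> x; rewrite expR_ge0/= ler_expR mulNr lerN2 ler_pM2r//.
  by rewrite expr2 ler_peMl//; near: x; apply: nbhs_pinfty_ge.
- by move=> x _; case: (dF x).
- by apply: cvgN; apply: cvg_at_right_filter; exact: cF.
- move=> x _; rewrite derive1E; exact: (@derive_val _ _ _ _ _ _ _ (dF x)).
Unshelve. all: by end_near. Qed.

Lemma half_moment_ge0 j : 0 <= half_moment j.
Proof.
apply: integral_ge0 => x /=; rewrite in_itv/= andbT => x0.
by rewrite lee_fin mulr_ge0 ?expR_ge0// exprn_ge0// ltW.
Qed.

(** Integration by parts in the form of Tonelli: x e^(-x^2/2) (j+1) s^j is integrated over 0 < s < x
    in both orders. The identity holds in the extended reals, before finiteness of the moments is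
    known. *)
Lemma half_momentS2 j : half_moment j.+2 = j.+1%:R%:E * half_moment j.
Proof.
pose f (z : R * R) : \bar R := if ((0 < z.2) && (z.2 < z.1))%R then
  (z.1 * expR (- z.1 ^+ 2 / 2) * (j.+1%:R * z.2 ^+ j))%:E else 0.
have f0 z : 0 <= f z.
  rewrite /f; case: ifPn => // /andP[z0 z1]; rewrite lee_fin.
  by rewrite !mulr_ge0 ?expR_ge0 ?exprn_ge0 ?ltW// (lt_trans z0).
have mf : measurable_fun setT f.
  apply: measurable_fun_ifT => //.
    by apply: measurable_and; exact: measurable_fun_ltr.
  apply/measurable_EFinP; apply: measurable_funM.
    apply: measurable_funM => //.
    exact: (measurableT_comp measurable_expR_sqr).
  by apply: measurable_funM => //; exact: measurable_funX.
have e1 (x : R) : \int[mu]_s f (x, s) =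
    if (0 < x)%R then (x ^+ j.+2 * expR (- x ^+ 2 / 2))%:E else 0.
  have [x0|x0] := ltP 0%R x; last first.
    apply: integral0_eq => s _; rewrite /f/= ifF//; apply/negbTE.
    by rewrite negb_and -!leNgt; case: leP => //= s0; rewrite (le_trans x0)// ltW.
  transitivity (\int[mu]_(s in `]0%R, x[)
      ((x * expR (- x ^+ 2 / 2))%:E * (j.+1%:R * s ^+ j)%:E)).
    rewrite [RHS]integral_mkcond; apply: eq_integral => s _.
    by rewrite patchE mem_setE/= in_itv/= /f/=; case: ifP => // _; rewrite EFinM.
  rewrite ge0_integralZl//.
  - by rewrite integral_pow// -EFinM [(x ^+ j.+2)%R]exprS; congr EFin; ring.
  - apply: measurable_funTS; exact/measurable_EFinP/measurable_funM.
  - move=> s /=; rewrite in_itv/= => /andP[s0 _].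
    by rewrite lee_fin mulr_ge0// exprn_ge0// ltW.
  - by rewrite lee_fin mulr_ge0 ?expR_ge0// ltW.
have e2 (s : R) : \int[mu]_x f (x, s) =
    if (0 < s)%R then (j.+1%:R * (s ^+ j * expR (- s ^+ 2 / 2)))%:E else 0.
  have [s0|s0] := ltP 0%R s; last first.
    by apply: integral0_eq => x _; rewrite /f/= ltNge s0.
  transitivity (\int[mu]_(x in `]s, +oo[)
      ((x * expR (- x ^+ 2 / 2))%:E * (j.+1%:R * s ^+ j)%:E)).
    rewrite [RHS]integral_mkcond; apply: eq_integral => x _.
    by rewrite patchE mem_setE/= in_itv/= andbT /f/= s0/=; case: ifP => // _; rewrite EFinM.
  rewrite ge0_integralZr//.
  - by rewrite integral_gaussian_tail ?ltW// -EFinM; congr EFin; ring.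
  - apply: measurable_funTS; have := measurable_half_moment 1.
    by under eq_fun do rewrite expr1.
  - move=> x /=; rewrite in_itv/= andbT => sx.
    by rewrite lee_fin mulr_ge0 ?expR_ge0// ltW// (lt_trans s0).
  - by rewrite lee_fin mulr_ge0// exprn_ge0// ltW.
have := fubini_tonelli (m1 := mu) (m2 := mu) f mf f0.
under eq_integral do rewrite e1.
under [in RHS]eq_integral do rewrite e2.
rewrite -!integral_restrict_gt0 /half_moment => ->.
under eq_integral do rewrite EFinM.
rewrite ge0_integralZl//.
- exact: measurable_funTS (measurable_half_moment j).
- move=> s /=; rewrite in_itv/= andbT => s0.
  by rewrite lee_fin mulr_ge0 ?expR_ge0// exprn_ge0// ltW.
Qed.

Lemma half_moment1 : half_moment 1 = 1.
Proof.
rewrite /half_moment; under eq_integral do rewrite expr1.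
by rewrite integral_gaussian_tail// expr0n/= oppr0 mul0r expR0.
Qed.

(** Half of the total mass of the standard normal density, freed from its normalizing factor. *)
Lemma half_moment0 : half_moment 0 = (Num.sqrt (2 * pi) / 2)%:E.
Proof.
have := @integral_normal_pdf R 0%R 1%R.
rewrite normal_pdfE ?oner_eq0//.
have peakE : (normal_peak 1 = (Num.sqrt (2 * pi))^-1 :> R)%R.
  by rewrite /normal_peak expr1n mul1r mulr_natl.
have sp : (0 < Num.sqrt (2 * pi) :> R)%R by rewrite sqrtr_gt0 mulr_gt0// pi_gt0.
have normE (x : R) : (normal_fun 0 1 x = expR (- x ^+ 2 / 2))%R.
  by rewrite /normal_fun subr0 expr1n.
under eq_integral do rewrite EFinM normE peakE.
rewrite ge0_integralZl//; last first.
  by apply/measurable_EFinP; exact: measurable_expR_sqr.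
rewrite (@ge0_symfun_integralT _ (fun x => expR (- x ^+ 2 / 2))%R); last 3 first.
- by move=> x; exact: expR_ge0.
- move=> x; apply: continuous_comp; last exact: continuous_expR.
  apply: cvgM; last exact: cvg_cst.
  by apply: cvgN; exact: exprn_continuous.
- by move=> x /=; rewrite sqrrN.
rewrite -set_itvcy -integral_itv_obnd_cbnd; last first.
  by apply: measurable_funTS; apply/measurable_EFinP; exact: measurable_expR_sqr.
have -> : \int[mu]_(x in `]0%R, +oo[) (expR (- x ^+ 2 / 2))%:E = half_moment 0.
  by apply: eq_integral => x _; rewrite expr0 mul1r.
set s := Num.sqrt _ in sp * => h.
rewrite -[RHS]mule1 -h !muleA -!EFinM.
by rewrite (_ : s / 2 * s^-1 * 2 = 1)%R ?mul1e//; field; lra.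
Qed.

Definition chi2_kernel (n : nat) (t : R) : R :=
  if (0 < t)%R then (powR t (n%:R / 2 - 1) * expR (- t / 2))%R else 0%R.

Lemma chi2_kernel_ge0 n t : (0 <= chi2_kernel n t)%R.
Proof. by rewrite /chi2_kernel; case: ifP => // _; rewrite mulr_ge0 ?powR_ge0 ?expR_ge0. Qed.

Lemma measurable_chi2_kernel n : measurable_fun setT (chi2_kernel n).
Proof.
apply: measurable_fun_ifT => //; first exact: measurable_fun_ltr.
apply: measurable_funM; first exact: measurable_powR.
by apply: measurableT_comp => //; exact: measurable_funM.
Qed.

Definition chi2_mass (n : nat) : \bar R := \int[mu]_t (chi2_kernel n t)%:E.

Lemma chi2_mass_half_moment n : chi2_mass n.+1 = 2%:E * half_moment n.
Proof.
have mk : measurable_fun setT (fun t => (chi2_kernel n.+1 t)%:E).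
  by apply/measurable_EFinP; exact: measurable_chi2_kernel.
transitivity (\int[mu]_(t in `]0%R, +oo[) (chi2_kernel n.+1 t)%:E).
  rewrite integral_restrict_gt0; apply: eq_integral => t _.
  by rewrite /chi2_kernel; case: ifP.
rewrite ge0_integral_sqr//; last by move=> x; rewrite lee_fin chi2_kernel_ge0.
rewrite /half_moment -ge0_integralZl//; first last.
- move=> s /=; rewrite in_itv/= andbT => s0.
  by rewrite lee_fin mulr_ge0 ?expR_ge0// exprn_ge0// ltW.
- exact: measurable_funTS (measurable_half_moment n).
apply: eq_integral => x; rewrite inE/= in_itv/= andbT => x0.
rewrite /chi2_kernel exprn_gt0// -!EFinM; congr EFin.
rewrite -powR_mulrn ?ltW// -powRrM.
have -> : (x ^+ n = powR x (2 * (n.+1%:R / 2 - 1)) * x)%R.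
  rewrite -[X in (_ * X)%R]powRr1 ?ltW// -powRD; last by rewrite (gt_eqF x0) /= implybT.
  by rewrite -powR_mulrn ?ltW// -natr1; congr powR; field.
by rewrite powR_mulrn ?ltW//; ring.
Qed.

Lemma chi2_massS2 n : (1 <= n)%N -> chi2_mass n.+2 = n%:R%:E * chi2_mass n.
Proof. by case: n => // n _; rewrite !chi2_mass_half_moment half_momentS2 muleCA. Qed.

Lemma chi2_mass1 : chi2_mass 1 = (Num.sqrt (2 * pi))%:E.
Proof.
by rewrite chi2_mass_half_moment half_moment0 -EFinM mulrC divfK.
Qed.

Lemma chi2_mass2 : chi2_mass 2 = 2%:E.
Proof. by rewrite chi2_mass_half_moment half_moment1 mule1. Qed.

Lemma chi2_mass_fin n : (1 <= n)%N -> chi2_mass n \is a fin_num.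
Proof.
move: n; apply: (@nat_ind2 (fun n => chi2_mass n \is a fin_num)).
- by rewrite chi2_mass1.
- by rewrite chi2_mass2.
- by move=> n n1 nfin; rewrite chi2_massS2//; exact: fin_numM.
Qed.

Lemma half_moment_fin n : half_moment n \is a fin_num.
Proof.
have := @chi2_mass_fin n.+1 isT.
rewrite chi2_mass_half_moment; have := half_moment_ge0 n.
by case: half_moment => // _; rewrite gt0_muley// lte_fin.
Qed.

(* From [x <= (l + x^2 / l) / 2] with [l = sqrt n]. *)
Lemma half_moment_le n : (1 <= n)%N ->
  half_moment n <= (Num.sqrt n%:R)%:E * half_moment n.-1.
Proof.
case: n => // n _; set l := Num.sqrt n.+1%:R.
have l0 : (0 < l)%R by rewrite sqrtr_gt0.
have l2 : (l * l = n.+1%:R)%R by rewrite -expr2 sqr_sqrtr.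
apply: (@le_trans _ _ ((l / 2)%:E * half_moment n + (l^-1 / 2)%:E * half_moment n.+2)).
  have mM k : measurable_fun (`]0%R, +oo[%classic : set R)
      (fun x : R => (x ^+ k * expR (- x ^+ 2 / 2))%:E).
    exact: measurable_funTS (measurable_half_moment k).
  have M0 k (x : R) : (`]0%R, +oo[%classic : set R) x ->
      0 <= (x ^+ k * expR (- x ^+ 2 / 2))%:E.
    rewrite /= in_itv/= andbT => x0.
    by rewrite lee_fin mulr_ge0 ?expR_ge0// exprn_ge0// ltW.
  have c0 : 0 <= (l / 2)%:E by rewrite lee_fin; lra.
  have d0 : 0 <= (l^-1 / 2)%:E by rewrite lee_fin divr_ge0// invr_ge0 ltW.
  rewrite /half_moment -!ge0_integralZl//; try exact: M0; try exact: mM.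
  rewrite -ge0_integralD//; first last.
  - by apply: measurable_funeM; exact: mM.
  - by move=> x /(M0 n.+2) ?; exact: mule_ge0.
  - by apply: measurable_funeM; exact: mM.
  - by move=> x /(M0 n) ?; exact: mule_ge0.
  apply: ge0_le_integral => //.
  - exact: M0.
  - exact: mM.
  - by apply: emeasurable_funD; apply: measurable_funeM; exact: mM.
  move=> x /=; rewrite in_itv/= andbT => x0.
  rewrite -!EFinM -EFinD lee_fin; set e := expR _.
  have p0 : (0 <= x ^+ n * e)%R by rewrite mulr_ge0 ?expR_ge0 ?exprn_ge0 ?ltW.
  rewrite -subr_ge0 (_ : _ - _ = (l - x) ^+ 2 / l / 2 * (x ^+ n * e))%R.
    by rewrite mulr_ge0// !divr_ge0 ?sqr_ge0 ?ltW.
  by rewrite [(x ^+ n.+2)%R]exprS [(x ^+ n.+1)%R]exprS; field; lra.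
rewrite half_momentS2 muleA -EFinM -l2 -(fineK (half_moment_fin n)).
rewrite -!EFinM -EFinD lee_fin.
by rewrite le_eqVlt; apply/orP; left; apply/eqP; field; lra.
Qed.

(** The last property is the square of [half_moment_le]. *)
Lemma chi2_norm_seq_mass : chi2_norm_seq (fun n => fine (chi2_mass n)).
Proof.
split.
- by rewrite chi2_mass1.
- by rewrite chi2_mass2.
- by move=> n n1; rewrite chi2_massS2// fineM// chi2_mass_fin.
- case=> // n _; rewrite !chi2_mass_half_moment !fineM ?half_moment_fin//=.
  have := @half_moment_le n.+1 isT.
  have a0 := half_moment_ge0 n.+1; have b0 := half_moment_ge0 n.
  rewrite -(fineK (half_moment_fin n.+1)) -(fineK (half_moment_fin n)) /= in a0 b0 *.
  rewrite -!EFinM !lee_fin in a0 b0 *; move=> h.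
  have : (fine (half_moment n.+1) ^+ 2 <=
      (Num.sqrt n.+1%:R * fine (half_moment n)) ^+ 2)%R.
    by rewrite ler_pXn2r ?nnegrE ?mulr_ge0 ?sqrtr_ge0.
  rewrite exprMn sqr_sqrtr//; set N := n.+1%:R; lra.
Qed.

Lemma chi2_mass_Gamma n : (1 <= n)%N ->
  fine (chi2_mass n) = (powR 2 (n%:R / 2) * Gamma (n%:R / 2))%R.
Proof.
move=> n1; rewrite /Gamma.
have mG : measurable_fun setT (fun t : R => (powR t (n%:R / 2 - 1) * expR (- t))%:E).
  apply/measurable_EFinP; apply: measurable_funM; first exact: measurable_powR.
  exact: measurableT_comp.
set G := \int[_]_(_ in _) _.
have E : chi2_mass n = (powR 2 (n%:R / 2))%:E * G.
  rewrite /chi2_mass (@ge0_integral_affine _ _ 2 0)//; last 2 first.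
  - by move=> x; rewrite lee_fin chi2_kernel_ge0.
  - by apply/measurable_EFinP; exact: measurable_chi2_kernel.
  have -> : (powR 2 (n%:R / 2) = 2 * powR 2 (n%:R / 2 - 1) :> R)%R.
    by rewrite mulr_powRB1// divr_gt0// ltr0n.
  rewrite [in RHS]EFinM -muleA; congr (_ * _).
  rewrite /G -ge0_integralZl//; first last.
  - by move=> x _; rewrite lee_fin mulr_ge0 ?powR_ge0 ?expR_ge0.
  - exact: measurable_funTS.
  rewrite integral_restrict_gt0; apply: eq_integral => x _.
  rewrite addr0 /chi2_kernel pmulr_rgt0//; case: ifP => // x0.
  rewrite -EFinM powRM ?(ltW x0)// -mulrA; congr (_ * (_ * expR _))%R%:E.
  by field.
(* [Gamma] is defined with [fine], which sends an infinite integral to 0, so the Gamma integral has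
   to be shown finite; this follows from the finiteness of [chi2_mass n]. *)
have := chi2_mass_fin n1; rewrite E => fG.
rewrite fineM//.
have : 0 <= G.
  by apply: integral_ge0 => x _; rewrite lee_fin mulr_ge0 ?powR_ge0 ?expR_ge0.
move: fG; case: G {E} => // /[swap] _.
by rewrite gt0_muley// lte_fin powR_gt0.
Qed.

Lemma chisq_pdfE n (t : R) : (1 <= n)%N ->
  chisq_pdf n t = (chi2_kernel n t / fine (chi2_mass n))%R.
Proof.
move=> n1; rewrite chi2_mass_Gamma// /chisq_pdf /chi2_kernel.
by case: ifP => // _; rewrite mul0r.
Qed.

End chi2_mass.

(** * Sums of squares of independent normal variables *)

Section chisq_law.
Local Open Scope ereal_scope.
Context {R : realType}.
Notation mu := (@lebesgue_measure R).

Lemma ge0_integral_even (f : R -> \bar R) : (forall x, 0 <= f x) ->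
  measurable_fun setT f -> (forall x, f (- x)%R = f x) ->
  \int[mu]_x f x = 2%:E * \int[mu]_(x in `]0%R, +oo[) f x.
Proof.
move=> f0 mf fN.
have mS D : measurable_fun D f by exact: measurable_funTS.
have -> : [set: R] = `]-oo, 0%R] `|` `]0%R, +oo[.
  apply/esym/seteqP; split => // x _ /=; rewrite !in_itv/= andbT.
  by case: leP; [left|right].
rewrite ge0_integral_setU//; last first.
- apply/disj_setPS => x [/=]; rewrite !in_itv/= andbT => x0.
  by rewrite ltNge x0.
- exact: mS.
have -> : \int[mu]_(x in `]-oo, 0%R]) f x = \int[mu]_(x in `]-oo, 0%R]) f (- x)%R.
  by apply: eq_integral => x _; rewrite fN.
rewrite -ge0_integration_by_substitution0// integral_itv_obnd_cbnd; last exact: mS.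
by rewrite mule_natl mule2n.
Qed.

Lemma chisq_pdf_ge0 n (t : R) : (1 <= n)%N -> (0 <= chisq_pdf n t)%R.
Proof.
move=> n1; rewrite chisq_pdfE// divr_ge0 ?chi2_kernel_ge0//.
exact: ltW (chi2_norm_seq_gt0 chi2_norm_seq_mass n1).
Qed.

Lemma measurable_chisq_pdf n : (1 <= n)%N -> measurable_fun setT (@chisq_pdf R n).
Proof.
move=> n1; rewrite (_ : chisq_pdf n = fun t => chi2_kernel n t / fine (@chi2_mass R n))%R.
  by apply: measurable_funM => //; exact: measurable_chi2_kernel.
by apply/funext => t; rewrite chisq_pdfE.
Qed.

Lemma integral_chisq_pdf n A : (1 <= n)%N -> measurable A ->
  \int[mu]_(t in A) (chisq_pdf n t)%:E =
  (fine (@chi2_mass R n))^-1%:E * \int[mu]_(t in A) (chi2_kernel n t)%:E.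
Proof.
move=> n1 mA; rewrite -ge0_integralZl//.
- by apply: eq_integral => t _; rewrite chisq_pdfE// mulrC EFinM.
- by apply: measurable_funTS; apply/measurable_EFinP; exact: measurable_chi2_kernel.
- by move=> t _; rewrite lee_fin chi2_kernel_ge0.
- rewrite lee_fin invr_ge0.
  exact: ltW (chi2_norm_seq_gt0 chi2_norm_seq_mass n1).
Qed.

Lemma integralT_chisq_pdf n : (1 <= n)%N -> \int[mu]_t (chisq_pdf n t)%:E = 1.
Proof.
move=> n1; rewrite integral_chisq_pdf// -/(chi2_mass n).
have := chi2_norm_seq_gt0 (@chi2_norm_seq_mass R) n1.
have := @chi2_mass_fin R n n1.
by case: chi2_mass => // r _ /= r0; rewrite -EFinM mulVf// gt_eqF.
Qed.

(** The even normal density reduces to twice its half-line integral, and the substitution t = x^2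
    matches it with the kernel t^(-1/2) e^(-t/2), of total mass sqrt (2 pi). *)
Lemma normal_prob_sqr A : measurable A ->
  normal_prob 0%R 1%R [set x : R | A (x ^+ 2)%R] = \int[mu]_(t in A) (chisq_pdf 1 t)%:E.
Proof.
move=> mA.
pose F (t : R) : \bar R := (\1_A t * chisq_pdf 1 t)%:E.
have F0 t : 0 <= F t by rewrite lee_fin mulr_ge0 ?chisq_pdf_ge0.
have mF : measurable_fun setT F.
  apply/measurable_EFinP; apply: measurable_funM; first exact: measurable_indic.
  exact: measurable_chisq_pdf.
have FE (f : R -> R) (B : set R) : \int[mu]_(t in B) (f t)%:E = \int[mu]_t (\1_B t * f t)%:E.
  rewrite integral_mkcond; apply: eq_integral => t _; rewrite patchE indicE.
  by case: ifP => _; rewrite ?mul1r ?mul0r.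
rewrite [RHS]FE (_ : \int[mu]_t _ = \int[mu]_(t in `]0%R, +oo[) F t); last first.
  rewrite integral_restrict_gt0; apply: eq_integral => t _.
  by rewrite /F /chisq_pdf; case: ifP => //; rewrite mulr0.
have mB : measurable_fun setT
    (fun x => (\1_[set x : R | A (x ^+ 2)%R] x * normal_pdf 0 1 x)%:E).
  apply/measurable_EFinP; apply: measurable_funM; last exact: measurable_normal_pdf.
  apply: measurable_indic; rewrite -[X in measurable X]setTI.
  have : measurable_fun setT (fun x : R => x ^+ 2)%R by exact: measurable_funX.
  by apply.
rewrite /normal_prob FE ge0_integral_even; last 3 first.
- by move=> x; rewrite lee_fin mulr_ge0 ?normal_pdf_ge0.
- exact: mB.
- move=> x; rewrite !indicE; congr (_ * _)%:E.
    by congr (nat_of_bool _)%:R; apply/idP/idP; rewrite !inE/= sqrrN.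
  by rewrite normal_pdfE ?oner_eq0// /normal_fun !subr0 sqrrN.
rewrite [RHS]ge0_integral_sqr// -ge0_integralZl//; first last.
- by move=> x _; rewrite lee_fin mulr_ge0 ?normal_pdf_ge0.
- by apply: measurable_funTS; exact: mB.
apply: eq_integral => x; rewrite inE/= in_itv/= andbT => x0.
rewrite /F -!EFinM !indicE chisq_pdfE// chi2_mass1 /= /chi2_kernel exprn_gt0//.
congr EFin.
have -> : (normal_pdf 0 1 x = (Num.sqrt (2 * pi))^-1 * expR (- x ^+ 2 / 2))%R.
  by rewrite normal_pdfE ?oner_eq0// /normal_peak /normal_fun subr0 expr1n mul1r mulr_natl.
have -> : (powR (x ^+ 2) (1%:R / 2 - 1) = x^-1)%R.
  rewrite -powR_mulrn ?ltW// -powRrM -[RHS]powR_inv1 ?ltW//.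
  by congr powR; field.
rewrite -[in RHS]mulrA; set b := nat_of_bool _; set s := Num.sqrt _.
have s0 : (0 < s)%R by rewrite sqrtr_gt0 mulr_gt0// pi_gt0.
by field; apply/andP; split; lra.
Qed.

Definition beta_kernel (m n : nat) (v : R) : R :=
  if ((0 < v) && (v < 1))%R then (powR v (m%:R / 2 - 1) * powR (1 - v) (n%:R / 2 - 1))%R
  else 0%R.

Lemma beta_kernel_ge0 m n v : (0 <= beta_kernel m n v)%R.
Proof. by rewrite /beta_kernel; case: ifP => // _; rewrite mulr_ge0 ?powR_ge0. Qed.

Lemma measurable_beta_kernel m n : measurable_fun setT (beta_kernel m n).
Proof.
apply: measurable_fun_ifT => //.
  by apply: measurable_and; exact: measurable_fun_ltr.
apply: measurable_funM; first exact: measurable_powR.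
by apply: (measurableT_comp (measurable_powR _)); exact: measurable_funB.
Qed.

Lemma chi2_kernel_scale m n (t v : R) : (0 < t)%R ->
  (t * (chi2_kernel m (t * v) * chi2_kernel n (t - t * v)) =
   chi2_kernel (m + n) t * beta_kernel m n v)%R.
Proof.
move=> t0; have -> : (t - t * v = t * (1 - v))%R by ring.
rewrite /chi2_kernel /beta_kernel !pmulr_rgt0// t0 subr_gt0.
case: ltP => v0; last by rewrite mul0r !mulr0.
case: ltP => v1; last by rewrite !mulr0.
rewrite !powRM ?(ltW t0) ?(ltW v0)//; last by rewrite subr_ge0 ltW.
have -> : powR t ((m + n)%:R / 2 - 1) = (t * powR t (m%:R / 2 - 1) * powR t (n%:R / 2 - 1))%R.
  rewrite -[X in (X * _ * _)%R]powRr1 ?ltW// -!powRD ?(gt_eqF t0) ?implybT//.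
  by congr powR; rewrite natrD; field.
have -> : expR (- t / 2) = (expR (- (t * v) / 2) * expR (- (t * (1 - v)) / 2))%R.
  by rewrite -expRD; congr expR; field.
rewrite /=; ring.
Qed.

(** With x = t v the exponentials combine to e^(-t/2) and the powers of t separate from those of v.
    What remains is a Beta integral, kept as an unevaluated constant independent of t. *)
Lemma chi2_kernel_conv m n (t : R) :
  \int[mu]_x (chi2_kernel m x * chi2_kernel n (t - x))%:E =
  (chi2_kernel (m + n) t)%:E * \int[mu]_v (beta_kernel m n v)%:E.
Proof.
have [t0|t0] := ltP 0%R t; last first.
  rewrite {1}/chi2_kernel [X in X%:E * _]/chi2_kernel ltNge t0/= mul0e.
  apply: integral0_eq => x _; rewrite /chi2_kernel.
  case: ltP => x0; last by rewrite mul0r.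
  by rewrite subr_gt0 ltNge (le_trans t0 (ltW x0)) mulr0.
rewrite (@ge0_integral_affine _ _ t 0)//; last 2 first.
- by move=> x; rewrite lee_fin mulr_ge0 ?chi2_kernel_ge0.
- apply/measurable_EFinP; apply: measurable_funM; first exact: measurable_chi2_kernel.
  by apply: (measurableT_comp (measurable_chi2_kernel _)); exact: measurable_funB.
rewrite -[LHS]ge0_integralZl//; first last.
- by rewrite lee_fin ltW.
- by move=> v _; rewrite lee_fin mulr_ge0 ?chi2_kernel_ge0.
- apply/measurable_EFinP; apply: measurable_funM.
    apply: (measurableT_comp (measurable_chi2_kernel _)).
    by apply: measurable_funD => //; exact: measurable_funM.
  apply: (measurableT_comp (measurable_chi2_kernel _)); apply: measurable_funB => //.
  by apply: measurable_funD => //; exact: measurable_funM.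
rewrite -ge0_integralZl//; first last.
- by rewrite lee_fin chi2_kernel_ge0.
- by move=> v _; rewrite lee_fin beta_kernel_ge0.
- by apply/measurable_EFinP; exact: measurable_beta_kernel.
by apply: eq_integral => v _; rewrite addr0 -!EFinM chi2_kernel_scale.
Qed.

(** The translation y = t - x and Tonelli bring the integral over x inside, where [chi2_kernel_conv]
    evaluates it. *)
Lemma chi2_kernel_convolution m n A : measurable A ->
  \int[mu]_x \int[mu]_y (\1_A (x + y) * (chi2_kernel m x * chi2_kernel n y))%:E =
  (\int[mu]_(t in A) (chi2_kernel (m + n) t)%:E) * \int[mu]_v (beta_kernel m n v)%:E.
Proof.
move=> mA; have mAi := @measurable_indic _ _ R setT A mA.
have tr x : \int[mu]_y (\1_A (x + y) * (chi2_kernel m x * chi2_kernel n y))%:E =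
    \int[mu]_t (\1_A t * (chi2_kernel m x * chi2_kernel n (t - x)))%:E.
  rewrite (@ge0_integral_affine _ _ 1 (- x)%R)//.
  - rewrite mul1e; apply: eq_integral => t _.
    by rewrite mul1r; congr (\1_A _ * _)%:E; ring.
  - by move=> y; rewrite lee_fin !mulr_ge0 ?chi2_kernel_ge0.
  - apply/measurable_EFinP; apply: measurable_funM.
      by apply: (measurableT_comp mAi); exact: measurable_funD.
    by apply: measurable_funM => //; exact: measurable_chi2_kernel.
under eq_integral do rewrite tr.
pose f (z : R * R) := (\1_A z.2 * (chi2_kernel m z.1 * chi2_kernel n (z.2 - z.1)))%:E.
have f0 z : 0 <= f z by rewrite lee_fin !mulr_ge0 ?chi2_kernel_ge0.
have mf : measurable_fun setT f.
  apply/measurable_EFinP; apply: measurable_funM.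
    exact: (measurableT_comp mAi).
  apply: measurable_funM; first exact: (measurableT_comp (measurable_chi2_kernel m)).
  apply: (measurableT_comp (measurable_chi2_kernel n)).
  exact: measurable_funB.
have := fubini_tonelli (m1 := mu) (m2 := mu) f mf f0.
rewrite /f/= => ->.
have inner t : \int[mu]_x (\1_A t * (chi2_kernel m x * chi2_kernel n (t - x)))%:E =
    (\1_A t * chi2_kernel (m + n) t)%:E * \int[mu]_v (beta_kernel m n v)%:E.
  under eq_integral do rewrite EFinM.
  rewrite ge0_integralZl//.
  - by rewrite chi2_kernel_conv muleA EFinM.
  - apply/measurable_EFinP; apply: measurable_funM; first exact: measurable_chi2_kernel.
    by apply: (measurableT_comp (measurable_chi2_kernel _)); exact: measurable_funB.
  - by move=> x _; rewrite lee_fin mulr_ge0 ?chi2_kernel_ge0.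
under eq_integral do rewrite inner.
rewrite ge0_integralZr//.
- congr (_ * _); rewrite [RHS]integral_mkcond; apply: eq_integral => t _.
  by rewrite patchE indicE; case: ifP => _; rewrite ?mul1r ?mul0r.
- apply/measurable_EFinP; apply: measurable_funM; first exact: mAi.
  exact: measurable_chi2_kernel.
- by move=> t _; rewrite lee_fin mulr_ge0 ?chi2_kernel_ge0.
- by apply: integral_ge0 => v _; rewrite lee_fin beta_kernel_ge0.
Qed.

Lemma chisq_pdf_convolution m n A : (1 <= m)%N -> (1 <= n)%N -> measurable A ->
  \int[mu]_x \int[mu]_y (\1_A (x + y) * (chisq_pdf m x * chisq_pdf n y))%:E =
  \int[mu]_(t in A) (chisq_pdf (m + n) t)%:E.
Proof.
move=> m1 n1 mA; have mn1 : (1 <= m + n)%N by rewrite (leq_trans m1)// leq_addr.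
have [Mm MmE] : exists M, fine (@chi2_mass R m) = M by eexists.
have [Mn MnE] : exists M, fine (@chi2_mass R n) = M by eexists.
have Mm0 : (0 < Mm)%R by rewrite -MmE; exact: (chi2_norm_seq_gt0 (@chi2_norm_seq_mass R) m1).
have Mn0 : (0 < Mn)%R by rewrite -MnE; exact: (chi2_norm_seq_gt0 (@chi2_norm_seq_mass R) n1).
set B := \int[mu]_v (beta_kernel m n v)%:E.
have conv D : measurable D ->
  \int[mu]_x \int[mu]_y (\1_D (x + y) * (chisq_pdf m x * chisq_pdf n y))%:E =
  ((Mm * Mn)^-1)%:E * ((\int[mu]_(t in D) (chi2_kernel (m + n) t)%:E) * B).
  move=> mD; have mDi := @measurable_indic _ _ R setT D mD.
  rewrite -chi2_kernel_convolution//.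
  have c0 : 0 <= ((Mm * Mn)^-1)%:E by rewrite lee_fin invr_ge0 (ltW (mulr_gt0 Mm0 Mn0)).
  have mxy : measurable_fun setT (fun z : R * R =>
      (\1_D (z.1 + z.2) * (chi2_kernel m z.1 * chi2_kernel n z.2))%:E).
    apply/measurable_EFinP; apply: measurable_funM.
      by apply: (measurableT_comp mDi); exact: measurable_funD.
    apply: measurable_funM; first exact: (measurableT_comp (measurable_chi2_kernel m)).
    exact: (measurableT_comp (measurable_chi2_kernel n)).
  rewrite -ge0_integralZl//; last 2 first.
  - apply: (measurable_fun_fubini_tonelli_F (m2 := mu) (fun z : R * R =>
      (\1_D (z.1 + z.2) * (chi2_kernel m z.1 * chi2_kernel n z.2))%:E)) => //.
    by move=> z; rewrite lee_fin !mulr_ge0 ?chi2_kernel_ge0.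
  - by move=> x _; apply: integral_ge0 => y _; rewrite lee_fin !mulr_ge0 ?chi2_kernel_ge0.
  apply: eq_integral => x _; rewrite -ge0_integralZl//; last 2 first.
  - exact: (measurable_fun_pair2 x mxy).
  - by move=> y _; rewrite lee_fin !mulr_ge0 ?chi2_kernel_ge0.
  apply: eq_integral => y _; rewrite -EFinM (chisq_pdfE _ m1) (chisq_pdfE _ n1) MmE MnE.
  congr EFin.
  have a0 := lt0r_neq0 Mm0; have b0 := lt0r_neq0 Mn0.
  by field; apply/andP; split.
(* The constants match because both sides are probability measures. *)
rewrite conv// integral_chisq_pdf//.
have := conv _ measurableT; rewrite -/(chi2_mass (m + n)).
under eq_integral do under eq_integral do rewrite indicT mul1r.
rewrite (_ : \int[mu]_x _ = 1); last first.
  have pm := measurable_chisq_pdf m1; have pn := measurable_chisq_pdf n1.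
  rewrite -[RHS](integralT_chisq_pdf m1); apply: eq_integral => x _.
  under eq_integral do rewrite EFinM.
  rewrite ge0_integralZl ?integralT_chisq_pdf ?mule1//.
  - exact/measurable_EFinP.
  - by move=> y _; rewrite lee_fin chisq_pdf_ge0.
  - by rewrite lee_fin chisq_pdf_ge0.
have := chi2_norm_seq_gt0 (@chi2_norm_seq_mass R) mn1.
have := @chi2_mass_fin R _ mn1.
case: (chi2_mass _) => // M _ /= M0.
set c := ((Mm * Mn)^-1)%R => h.
(* [h] reads 1 = c (M B). As [B] is not known to be finite, M is cancelled by multiplying by its
   inverse rather than by dividing. *)
have cB : c%:E * B = (M^-1)%:E.
  have -> : c%:E * B = (M^-1)%:E * (c%:E * (M%:E * B)).
    rewrite !muleA -!EFinM (_ : M^-1 * c * M = c)%R//.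
    by rewrite mulrAC mulVf ?mul1r// gt_eqF.
  by rewrite -h mule1.
by rewrite muleCA muleC cB.
Qed.

End chisq_law.

(** * Joint law of two consecutive blocks of squares *)

Section joint_law.
Local Open Scope ereal_scope.
Context d (T : measurableType d) (R : realType) (P : probability T R).
Notation mu := (@lebesgue_measure R).

Let measurable_chisq_patch n (D : set R) : (1 <= n)%N -> measurable D ->
  measurable_fun setT ((fun t => (@chisq_pdf R n t)%:E) \_ D).
Proof.
move=> n1 mD; apply/(measurable_restrictT _ mD); apply/measurable_EFinP.
exact: measurable_funTS (measurable_chisq_pdf n1).
Qed.

(** Both sides are finite measures in [C]: the law of (X, Y) under P restricted to [G], and c times
    a product density. They agree on rectangles, hence everywhere. Carrying [G] along lets the
    statement be used inside an induction, with other variables already constrained. *)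
Lemma joint_chisq (G : set T) (X Y : T -> R) (c : \bar R) m n :
  measurable G -> measurable_fun setT X -> measurable_fun setT Y ->
  c \is a fin_num -> 0 <= c -> (1 <= m)%N -> (1 <= n)%N ->
  (forall A B, measurable A -> measurable B ->
    P (G `&` [set w | A (X w) /\ B (Y w)]) =
    c * (\int[mu]_(t in A) (chisq_pdf m t)%:E * \int[mu]_(t in B) (chisq_pdf n t)%:E)) ->
  forall C : set (R * R), measurable C ->
    P (G `&` [set w | C (X w, Y w)]) =
    c * \int[mu]_x \int[mu]_y (\1_C (x, y) * (chisq_pdf m x * chisq_pdf n y))%:E.
Proof.
move=> mG mX mY cfin c0 m1 n1 rect C mC.
have pm := measurable_chisq_pdf m1 (R := R); have pn := measurable_chisq_pdf n1 (R := R).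
pose f (z : R * R) : R := (chisq_pdf m z.1 * chisq_pdf n z.2)%R.
have f0 z : (0 <= f z)%R by rewrite mulr_ge0 ?chisq_pdf_ge0.
have mf : measurable_fun setT f.
  apply: measurable_funM; first exact: (measurableT_comp pm).
  exact: (measurableT_comp pn).
have [nu nuE] := density_measure (mu \x mu) f0 mf.
have nuI D : measurable D ->
    nu D = \int[mu]_x \int[mu]_y (\1_D (x, y) * (chisq_pdf m x * chisq_pdf n y))%:E.
  move=> mD; rewrite nuE integral_mkcond.
  rewrite -(fubini_tonelli1 (m1 := mu) (m2 := mu)
    (fun z : R * R => (\1_D z * (chisq_pdf m z.1 * chisq_pdf n z.2))%:E)).
  - apply: eq_integral => z _; rewrite patchE indicE.
    by case: ifP => _; rewrite ?mul1r ?mul0r.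
  - by apply/measurable_EFinP; apply: measurable_funM => //; exact: measurable_indic.
  - by move=> z; rewrite lee_fin mulr_ge0// f0.
pose XY w : measurableTypeR R * measurableTypeR R := (X w, Y w).
have mXY : measurable_fun setT XY by exact: measurable_fun_pair.
have [nu1 nu1E] := pushforward_measure (mrestr P mG) mXY.
have fc0 : (0 <= fine c)%R by exact: fine_ge0.
pose nu2 := mscale (NngNum fc0) nu.
have : nu1 C = nu2 C.
  apply: (measure_unique_rectangle (m1 := nu1) (m2 := mscale (NngNum fc0) nu)) => //.
    rewrite nu1E /pushforward/= /mrestr preimage_setT setTI.
    by rewrite (le_lt_trans (probability_le1 _ _))// ltry.
  move=> A B mA mB; rewrite nu1E /pushforward /nu2/= /mscale/= /mrestr setIC.
  rewrite rect// nuI//; last exact: measurableX.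
  rewrite fineK//; congr (c * _).
  rewrite [X in X * _]integral_mkcond -ge0_integralZr//; last 3 first.
  - exact: (measurable_chisq_patch m1 mA).
  - by move=> x _; rewrite patchE; case: ifP => //; rewrite lee_fin chisq_pdf_ge0.
  - by apply: integral_ge0 => y _; rewrite lee_fin chisq_pdf_ge0.
  apply: eq_integral => x _; rewrite patchE.
  rewrite integral_mkcond.
  case: ifPn => xA; last first.
    rewrite mul0e; apply/esym/integral0_eq => y _.
    rewrite indicE memNset ?mul0r// => -[/= Ax _].
    by move/negP : xA; apply; rewrite inE.
  rewrite -ge0_integralZl//; last 3 first.
  - exact: (measurable_chisq_patch n1 mB).
  - by move=> y _; rewrite patchE; case: ifP => //; rewrite lee_fin chisq_pdf_ge0.
  - by rewrite lee_fin chisq_pdf_ge0.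
  apply: eq_integral => y _; rewrite patchE indicE.
  have -> : ((x, y) \in A `*` B) = (y \in B).
    apply/idP/idP; rewrite !inE/=; first by case.
    by move: xA; rewrite inE.
  by case: ifP => _; rewrite ?mul1r ?mul0r ?mule0.
rewrite nu1E /pushforward /nu2/= /mscale/= /mrestr setIC => ->.
by rewrite nuI// fineK.
Qed.

Variable z : nat -> {RV P >-> R}.

(** Independence of [E] from all variables of index at least a, tested on finite products as in
    [iid_std_normal]. It stands for [E] being determined by earlier variables. *)
Definition indep_from (a : nat) (E : set T) : Prop :=
  forall (S : seq nat) (B : nat -> set R), uniq S -> {in S, forall j, (a <= j)%N} ->
    (forall j, j \in S -> measurable (B j)) ->
    P (E `&` \bigcap_(j in [set j | j \in S]) (z j @^-1` B j)) =
    P E * \prod_(j <- S) P (z j @^-1` B j).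

(** The hypothesis is applied to the lists [a] and a :: S. *)
Lemma indep_from_cons a E A : measurable A -> indep_from a E ->
  indep_from a.+1 (E `&` z a @^-1` A) /\
  P (E `&` z a @^-1` A) = P E * P (z a @^-1` A).
Proof.
move=> mA iE.
have P1 : P (E `&` z a @^-1` A) = P E * P (z a @^-1` A).
  have := iE [:: a] (fun=> A) isT.
  rewrite big_seq1 => <-//; last by move=> j; rewrite inE => /eqP ->.
  congr (P (E `&` _)); apply/seteqP; split => w /=.
    by move=> Aw j /=; rewrite inE => /eqP ->.
  by apply; rewrite /= inE.
split => // S B uS Sa mB; rewrite P1 -muleA.
have aS : a \notin S by apply/negP => /Sa; rewrite ltnn.
have := iE (a :: S) (fun j => if j == a then A else B j).
rewrite /= aS uS big_cons eqxx => /(_ isT) h.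
have eqB j : j \in S -> (if j == a then A else B j) = B j.
  by case: eqP => // -> ; rewrite (negbTE aS).
rewrite (_ : \prod_(j <- S) P (z j @^-1` B j) =
   \prod_(j <- S) P (z j @^-1` (if j == a then A else B j))); last first.
  by apply: eq_big_seq => j jS; rewrite eqB.
rewrite -h.
- rewrite -setIA; congr (P (E `&` _)); apply/seteqP; split => w /=.
    move=> [Aw Bw] j /=; rewrite inE => /predU1P[->|jS]; first by rewrite eqxx.
    by rewrite eqB//; exact: Bw.
  move=> Bw; split; first by have := Bw a; rewrite /= mem_head eqxx; exact.
  by move=> j /= jS; have := Bw j; rewrite /= inE jS orbT eqB//; exact.
- by move=> j; rewrite inE => /predU1P[->//|/Sa /ltnW].
- by move=> j; rewrite inE => /predU1P[->|jS]; rewrite ?eqxx ?eqB//; exact: mB.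
Qed.

(* Peeling the variables off from the front, with a tail event kept aside, requires
   joint laws of two variables only. *)
Definition tail_event (a : nat) (F : set T) (q : \bar R) : Prop :=
  forall E, measurable E -> indep_from a E -> P (E `&` F) = P E * q.

Definition sqsum (a n : nat) (w : T) : R := (\sum_(j < n) z (a + j)%N w ^+ 2)%R.

Lemma sqsumS a n w : sqsum a n.+1 w = (z a w ^+ 2 + sqsum a.+1 n w)%R.
Proof.
rewrite /sqsum big_ord_recl addn0; congr (_ + _)%R.
by apply: eq_bigr => j _; rewrite /bump /= addnA addn1.
Qed.

Lemma measurable_sqsum a n : measurable_fun setT (sqsum a n).
Proof.
by apply: measurable_sum => j; apply: measurable_funX; exact: measurable_funP.
Qed.

Hypothesis z_normal : forall j A, measurable A -> P (z j @^-1` A) = normal_prob 0%R 1%R A.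

(** The condition on z_a is absorbed into [E], which stays independent of the variables from a+1
    on. *)
Lemma tail_event_sqr a F q A : measurable A -> tail_event a.+1 F q ->
  tail_event a ([set w | A (z a w ^+ 2)%R] `&` F)
    ((\int[mu]_(t in A) (chisq_pdf 1 t)%:E) * q).
Proof.
move=> mA tF E mE iE; pose A2 := [set x : R | A (x ^+ 2)%R].
have mA2 : measurable A2.
  rewrite -[X in measurable X]setTI.
  have : measurable_fun setT (fun x : R => x ^+ 2)%R by exact: measurable_funX.
  by apply.
have [i1 P1] := indep_from_cons mA2 iE.
rewrite setIA -[X in E `&` X]/(z a @^-1` A2) tF//.
  by rewrite P1 z_normal// normal_prob_sqr// muleA.
by apply: measurableI => //; rewrite -[X in measurable X]setTI; exact: measurable_funP.
Qed.

(** Induction on the length of the block. The induction hypothesis for the n variables after z_a,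
    combined with [tail_event_sqr], gives the joint law of z_a^2 and the remaining sum on
    rectangles; [joint_chisq] extends it to the event that their sum lies in [A], and convolution
    adds the degrees of freedom. *)
Lemma tail_event_sqsum a n F q A : measurable F -> q \is a fin_num -> 0 <= q ->
  (1 <= n)%N -> measurable A -> tail_event (a + n) F q ->
  tail_event a ([set w | A (sqsum a n w)] `&` F)
    ((\int[mu]_(t in A) (chisq_pdf n t)%:E) * q).
Proof.
move=> mF qfin q0; case: n => // n _; elim: n a A => [|n IHn] a A mA tF.
  rewrite addn1 in tF; have := tail_event_sqr mA tF.
  rewrite (_ : [set w | A (z a w ^+ 2)%R] = [set w | A (sqsum a 1 w)])//.
  apply/seteqP; split => w /=; by rewrite sqsumS /sqsum big_ord0 addr0.
move=> E mE iE.
pose C : set (R * R) := [set xy | A (xy.1 + xy.2)%R].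
have mC : measurable C.
  rewrite -[X in measurable X]setTI.
  by apply: (measurable_funD measurable_fst measurable_snd).
have -> : E `&` ([set w | A (sqsum a n.+2 w)] `&` F) =
    (E `&` F) `&` [set w | C ((z a w ^+ 2)%R, sqsum a.+1 n.+1 w)].
  by apply/seteqP; split => w /=; rewrite /C/= -sqsumS; [move=> [? []]|move=> [[]]].
(* Here [G] is [E] together with [F], whose probability is the factor [P E * q]. *)
rewrite (@joint_chisq _ _ _ (P E * q) 1 n.+1)//.
- rewrite -muleA; congr (_ * _); rewrite [RHS]muleC; congr (_ * _).
  by rewrite -[n.+2]/(1 + n.+1)%N -chisq_pdf_convolution.
- exact: measurableI.
- by apply: measurable_funX; exact: measurable_funP.
- exact: measurable_sqsum.
- by rewrite fin_numM// fin_num_measure.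
- by rewrite mule_ge0.
move=> A1 A2 mA1 mA2.
have tF' : tail_event (a.+1 + n.+1) F q by rewrite addSnnS.
have := tail_event_sqr mA1 (IHn _ _ mA2 tF') mE iE.
have -> : E `&` ([set w | A1 (z a w ^+ 2)%R] `&`
      ([set w | A2 (sqsum a.+1 n.+1 w)] `&` F)) =
    E `&` F `&` [set w | A1 (z a w ^+ 2)%R /\ A2 (sqsum a.+1 n.+1 w)].
  by apply/seteqP; split => w /=; [move=> [? [? []]]|move=> [[? ?] []]].
by move=> ->; rewrite -muleA; congr (_ * _); rewrite muleA muleC.
Qed.

End joint_law.

(** [tail_event_sqsum] is used twice: for the second block with the sure event as tail, then for the
    first block with the event on the second block as tail. This gives the law on rectangles. *)
Lemma prob_sqsum d (T : measurableType d) (R : realType) (P : probability T R)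
    (z : nat -> {RV P >-> R}) (m n : nat) (C : set (R * R)) :
  iid_std_normal z -> (1 <= m)%N -> (1 <= n)%N -> measurable C ->
  (P [set w | C (sqsum z 0 m w, sqsum z m n w)] =
  \int[lebesgue_measure]_x \int[lebesgue_measure]_y
    (\1_C (x, y) * (chisq_pdf m x * chisq_pdf n y))%:E)%E.
Proof.
move=> [zN zI] m1 n1 mC.
have tT a : tail_event z a setT 1%E by move=> E mE _; rewrite setIT mule1.
have iT : indep_from z 0 setT.
  by move=> S B uS _ mB; rewrite setTI probability_setT mul1e; exact: zI.
have fin1 : (1%E : \bar R) \is a fin_num by [].
have := @joint_chisq d T R P setT (sqsum z 0 m) (sqsum z m n) 1%E m n measurableT
  (measurable_sqsum z 0 m) (measurable_sqsum z m n) fin1 lee01 m1 n1 _ C mC.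
rewrite setTI mul1e; apply => A B mA mB.
pose q := (\int[@lebesgue_measure R]_(t in B) (chisq_pdf n t)%:E)%E.
have tB := tail_event_sqsum zN measurableT fin1 lee01 n1 mB (tT (m + n)%N).
have mF : measurable ([set w | B (sqsum z m n w)] `&` setT).
  by rewrite setIT; have := measurable_sqsum z m n measurableT mB; rewrite setTI.
have q0 : (0 <= q)%E by apply: integral_ge0 => t _; rewrite lee_fin chisq_pdf_ge0.
have q1 : (q <= 1)%E.
  rewrite -(integralT_chisq_pdf n1); apply: ge0_subset_integral => //.
  - by apply/measurable_EFinP; exact: measurable_chisq_pdf.
  - by move=> t _; rewrite lee_fin chisq_pdf_ge0.
have qfin : q \is a fin_num by rewrite ge0_fin_numE// (le_lt_trans q1)// ltry.
rewrite -/q mule1 in tB.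
have := tail_event_sqsum (a := 0) zN mF qfin q0 m1 mA tB measurableT iT.
rewrite setTI probability_setT !mul1e setIT => <-; congr (P _).
by rewrite setTI; apply/seteqP; split.
Qed.

(** * Chi-square tails *)

Section chisq_tail.
Local Open Scope ereal_scope.
Context {R : realType}.
Notation mu := (@lebesgue_measure R).

Definition chisq_tail (n : nat) (u : R) : \bar R :=
  \int[mu]_(y in `]u, +oo[) (chisq_pdf n y)%:E.

Lemma integral_expR_tail (c u : R) : (0 < c)%R ->
  \int[mu]_(y in `]u, +oo[) (expR (- (c * y)))%:E = (c^-1 * expR (- (c * u)))%:E.
Proof.
move=> c0.
have ce (y : R) : (fun y : R => expR (- (c * y))%R) x @[x --> y] --> expR (- (c * y))%R.
  apply: continuous_comp; last exact: continuous_expR.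
  by apply: cvgN; apply: cvgM; [exact: cvg_cst|exact: cvg_id].
have dF (y : R) : is_derive (y : R) (1%R : R) (fun y : R => - (c^-1 * expR (- (c * y))))%R
    (expR (- (c * y))%R).
  by apply: is_derive_eq; rewrite /GRing.scale/=; field; lra.
rewrite integral_itv_obnd_cbnd; last first.
  apply: measurable_funTS; apply/measurable_EFinP; apply: measurableT_comp => //.
  by apply: measurableT_comp => //; exact: measurable_funM.
rewrite (@ge0_continuous_FTC2y _ _ (fun y => - (c^-1 * expR (- (c * y))))%R _ 0%R).
- by rewrite EFinN oppeK add0e.
- by move=> y _; exact: expR_ge0.
- by apply: continuous_subspaceT => y; exact: ce.
- rewrite -oppr0; apply: cvgN; rewrite -[X in _ --> X](mulr0 c^-1%R).
  apply: cvgM; first exact: cvg_cst.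
  apply: (@cvg_comp _ _ _ (fun y : R => (c * y)%R) (fun x => expR (- x))
    _ (pinfty_nbhs R)); last exact: cvgr_expR.
  exact: gt0_cvgMry.
- by move=> y _; case: (dF y).
- apply: cvgN; apply: cvg_at_right_filter; apply: cvgM; [exact: cvg_cst|exact: ce].
- move=> y _; rewrite derive1E; exact: (@derive_val _ _ _ _ _ _ _ (dF y)).
Qed.

Let measurable_exp (c : R) D :
  measurable_fun D (fun y : R => (expR (- (c * y)))%:E).
Proof.
apply: measurable_funTS; apply/measurable_EFinP; apply: measurableT_comp => //.
by apply: measurableT_comp => //; exact: measurable_funM.
Qed.

Lemma chisq_tail_ge0 n u : (1 <= n)%N -> 0 <= chisq_tail n u.
Proof. by move=> n1; apply: integral_ge0 => y _; rewrite lee_fin chisq_pdf_ge0. Qed.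

Lemma chisq_tail_le0 n u : (1 <= n)%N -> (u <= 0)%R -> chisq_tail n u = 1.
Proof.
move=> n1 u0; rewrite -(integralT_chisq_pdf n1) /chisq_tail integral_mkcond.
apply: eq_integral => y _; rewrite patchE mem_setE/= in_itv/= andbT.
by case: ltP => // yu; rewrite /chisq_pdf ltNge (le_trans yu).
Qed.

Lemma chisq_tail_le1 n u : (1 <= n)%N -> chisq_tail n u <= 1.
Proof.
move=> n1; rewrite -(integralT_chisq_pdf n1); apply: ge0_subset_integral => //.
- by apply/measurable_EFinP; exact: measurable_chisq_pdf.
- by move=> t _; rewrite lee_fin chisq_pdf_ge0.
Qed.

Lemma chisq_tail_ge n u : (2 <= n)%N -> (0 <= u)%R ->
  (powR u (n%:R / 2 - 1) * expR (- (u - n%:R) / 2) / powR n%:R ((n%:R - 1) / 2) / 2)%:E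
    <= chisq_tail n u.
Proof.
move=> n2 u0; have n1 := ltnW n2.
have n20 : (2 <= n%:R :> R)%R by rewrite ler_nat.
have := chi2_norm_seq_gt0 (@chi2_norm_seq_mass R) n1.
have := chi2_norm_seq_le (@chi2_norm_seq_mass R) n2.
move e : (fine _) => W Wle W0.
set a := (n%:R / 2 - 1)%R; have a0 : (0 <= a)%R by rewrite /a; lra.
apply: (@le_trans _ _ (\int[mu]_(y in `]u, +oo[)
    ((powR u a / W)%:E * (expR (- (2^-1 * y)))%:E))); last first.
  apply: ge0_le_integral => //.
  - by move=> y _; rewrite mule_ge0// lee_fin ?expR_ge0// divr_ge0 ?powR_ge0// ltW.
  - by apply: measurable_funeM; exact: measurable_exp.
  - apply: measurable_funTS; apply/measurable_EFinP; exact: measurable_chisq_pdf.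
  move=> y /=; rewrite in_itv/= andbT => uy; have y0 := le_lt_trans u0 uy.
  rewrite chisq_pdfE// e /chi2_kernel y0 -EFinM lee_fin -/a.
  rewrite mulrAC ler_wpM2r ?invr_ge0 ?(ltW W0)//.
  rewrite (_ : - (2^-1 * y) = - y / 2)%R; last by field.
  by rewrite ler_wpM2r ?expR_ge0// ge0_ler_powR ?nnegrE// ltW.
rewrite ge0_integralZl//; last 2 first.
- exact: measurable_exp.
- by rewrite lee_fin divr_ge0 ?powR_ge0// ltW.
rewrite integral_expR_tail// -EFinM lee_fin.
set k := powR n%:R _ in Wle *; set ua := powR u a.
have k0 : (0 < k)%R by rewrite powR_gt0; lra.
have -> : (expR (- (u - n%:R) / 2) = expR (- (2^-1 * u)) * (expR (- n%:R / 2))^-1)%R.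
  by rewrite -expRN -expRD; congr expR; field.
set en := expR (- n%:R / 2) in Wle *; set eu := expR _.
have en0 : (0 < en)%R by exact: expR_gt0.
(* The factor 1/2 of the statement is 2/4: the integral of e^(-y/2) contributes 2, and the Stirling
   bound on W contributes 4. *)
rewrite [leLHS](_ : _ = (ua * eu * 2) * (4 * (k * en))^-1)%R; last first.
  by field; apply/andP; split; lra.
rewrite [leRHS](_ : _ = (ua * eu * 2) * W^-1)%R; last by field; lra.
rewrite ler_wpM2l ?mulr_ge0 ?powR_ge0 ?expR_ge0//.
by rewrite lef_pV2 ?posrE ?mulr_gt0.
Qed.

(* [y^a <= u^a e^(a (y - u) / u)] reduces the tail to an exponential integral. *)
Lemma chisq_tail_le n u : (2 <= n)%N -> (n%:R - 2 < u)%R ->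
  chisq_tail n u <=
  (powR u (n%:R / 2) / (u - n%:R + 2) * expR (- (u - n%:R) / 2) /
    powR n%:R ((n%:R - 1) / 2) / Num.sqrt pi)%:E.
Proof.
move=> n2 nu; have n1 := ltnW n2.
have n20 : (2 <= n%:R :> R)%R by rewrite ler_nat.
have u0 : (0 < u)%R by lra.
have := chi2_norm_seq_gt0 (@chi2_norm_seq_mass R) n1.
have := chi2_norm_seq_ge (@chi2_norm_seq_mass R) n1.
move e : (fine _) => W Wge W0.
pose a : R := (n%:R / 2 - 1)%R; have a0 : (0 <= a)%R by rewrite /a; lra.
have au : (a / u < 1 / 2)%R by rewrite ltr_pdivrMr// /a; lra.
(* The decay rate left once e^(a y/u) is absorbed. It equals (u - n + 2)/(2u), which is positive
   exactly because u > n - 2 and whose inverse yields the factor u/(u - n + 2). *)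
pose c : R := (1 / 2 - a / u)%R; have c0 : (0 < c)%R by rewrite /c; lra.
apply: (@le_trans _ _ (\int[mu]_(y in `]u, +oo[)
    ((powR u a * expR (- a) / W)%:E * (expR (- (c * y)))%:E))).
  apply: ge0_le_integral => //.
  - by move=> y _; rewrite lee_fin chisq_pdf_ge0.
  - apply: measurable_funTS; apply/measurable_EFinP; exact: measurable_chisq_pdf.
  - by apply: measurable_funeM; exact: measurable_exp.
  move=> y /=; rewrite in_itv/= andbT => uy; have y0 := lt_trans u0 uy.
  rewrite chisq_pdfE// e /chi2_kernel y0 -EFinM lee_fin -/a.
  rewrite [leRHS]mulrAC ler_wpM2r ?invr_ge0 ?(ltW W0)//.
  have -> : powR y a = (powR u a * powR (y / u) a)%R.
    by rewrite -powRM ?divr_ge0 ?(ltW u0) ?(ltW y0)//; congr powR; field; lra.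
  rewrite -!mulrA ler_wpM2l ?powR_ge0// -expRD.
  have -> : (expR (- a + - (c * y)) = expR (a * (y / u - 1)) * expR (- y / 2))%R.
    by rewrite -expRD; congr expR; rewrite /c; field; lra.
  (* Comparing exponents leaves ln (y/u) <= y/u - 1. *)
  rewrite ler_wpM2r ?expR_ge0// /powR gt_eqF ?divr_gt0// ler_expR ler_wpM2l//.
  have -> : (y / u = 1 + (y / u - 1))%R by ring.
  have yu : (0 < y / u)%R by rewrite divr_gt0.
  by apply: (le_trans (le_ln1Dx _)); lra.
rewrite ge0_integralZl//; last 2 first.
- exact: measurable_exp.
- by rewrite lee_fin !mulr_ge0 ?powR_ge0 ?expR_ge0// invr_ge0 ltW.
rewrite integral_expR_tail// -EFinM lee_fin.
set k := powR n%:R _ in Wge *.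
have k0 : (0 < k)%R by rewrite powR_gt0; lra.
have -> : (powR u (n%:R / 2) = u * powR u a)%R by rewrite mulr_powRB1 ?ltW//; lra.
set ua := powR u a.
have -> : (expR (- (u - n%:R) / 2) = expR (- a) * expR (- (c * u)) * (expR (- n%:R / 2))^-1)%R.
  by rewrite -expRN -!expRD; congr expR; rewrite /c; field; lra.
set en := expR (- n%:R / 2) in Wge *; set ea := expR (- a); set eu := expR (- (c * u)).
have en0 : (0 < en)%R by exact: expR_gt0.
have sp : (0 < Num.sqrt pi :> R)%R by rewrite sqrtr_gt0 pi_gt0.
have cE : (c^-1 = 2 * u / (u - n%:R + 2))%R.
  by rewrite /c /a; field; rewrite -?andbA; do ?[apply/andP; split]; lra.
rewrite cE.
rewrite [leRHS](_ : _ = (ua * ea * eu * (2 * u / (u - n%:R + 2))) *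
   (2 * Num.sqrt pi * (k * en))^-1)%R; last first.
  by field; do ?[apply/andP; split]; lra.
rewrite [leLHS](_ : _ = (ua * ea * eu * (2 * u / (u - n%:R + 2))) * W^-1)%R; last first.
  by field; do ?[apply/andP; split]; lra.
rewrite ler_wpM2l//.
  rewrite !mulr_ge0 ?powR_ge0 ?expR_ge0 ?(ltW u0)// invr_ge0; lra.
by rewrite lef_pV2 ?posrE ?mulr_gt0.
Qed.

End chisq_tail.

(** * Integration over the value of the first block *)

Section decomposition.
Local Open Scope ereal_scope.
Context {R : realType}.
Notation mu := (@lebesgue_measure R).

(** By Tonelli, as a partial integral of a nonnegative measurable function on the plane. *)
Lemma measurable_chisq_tail n : (1 <= n)%N -> measurable_fun setT (@chisq_tail R n).
Proof.
move=> n1.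
pose f (z : R * R) : \bar R := (if (z.1 < z.2)%R then chisq_pdf n z.2 else 0%R)%:E.
have f0 z : 0 <= f z by rewrite lee_fin; case: ifP => // _; exact: chisq_pdf_ge0.
have mf : measurable_fun setT f.
  apply/measurable_EFinP; apply: measurable_fun_ifT => //.
    exact: measurable_fun_ltr.
  exact: (measurableT_comp (measurable_chisq_pdf n1)).
have := measurable_fun_fubini_tonelli_F (m2 := mu) f mf f0.
congr (measurable_fun _ _); apply/funext => u.
rewrite /fubini_F /chisq_tail [RHS]integral_mkcond; apply: eq_integral => y _.
by rewrite patchE mem_setE/= in_itv/= andbT /f/=; case: ifP.
Qed.

Definition chisq_pdf_tail (m n : nat) (b x : R) : \bar R :=
  (chisq_pdf m x)%:E * chisq_tail n (b - x)%R.

Lemma chisq_pdf_tail_ge0 m n b x : (1 <= m)%N -> (1 <= n)%N -> 0 <= chisq_pdf_tail m n b x.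
Proof. by move=> m1 n1; rewrite mule_ge0 ?chisq_tail_ge0// lee_fin chisq_pdf_ge0. Qed.

Lemma measurable_chisq_pdf_tail m n b D : (1 <= m)%N -> (1 <= n)%N ->
  measurable_fun D (chisq_pdf_tail m n b).
Proof.
move=> m1 n1; apply: measurable_funTS; apply: emeasurable_funM.
  by apply/measurable_EFinP; exact: measurable_chisq_pdf.
apply: (measurableT_comp (measurable_chisq_tail n1)).
exact: measurable_funB.
Qed.

Lemma prob_sqsum_gt d (T : measurableType d) (P : probability T R)
    (z : nat -> {RV P >-> R}) (m n : nat) (a b : R) :
  iid_std_normal z -> (1 <= m)%N -> (1 <= n)%N -> (a <= b)%R ->
  P [set w | (a < sqsum z 0 m w)%R /\ (b < sqsum z 0 m w + sqsum z m n w)%R] =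
  \int[mu]_(t in `]b, +oo[) (chisq_pdf m t)%:E +
  \int[mu]_(t in `]a, b]) chisq_pdf_tail m n b t.
Proof.
move=> iid m1 n1 ab.
pose C : set (R * R) := [set xy | (a < xy.1)%R && (b < xy.1 + xy.2)%R].
have mC : measurable C.
  have mf : measurable_fun setT (fun xy : R * R => (a < xy.1)%R && (b < xy.1 + xy.2)%R).
    apply: measurable_and; first exact: measurable_fun_ltr.
    by apply: measurable_fun_ltr => //; exact: measurable_funD.
  by rewrite -[X in measurable X]setTI; exact: (@mf measurableT [set true]).
have := prob_sqsum iid m1 n1 mC.
have -> : [set w | C (sqsum z 0 m w, sqsum z m n w)] =
    [set w | (a < sqsum z 0 m w)%R /\ (b < sqsum z 0 m w + sqsum z m n w)%R].
  by apply/seteqP; split => w /=; [move=> /andP[]|move=> [? ?]; apply/andP].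
move=> ->.
transitivity (\int[mu]_(x in `]a, +oo[) chisq_pdf_tail m n b x).
  rewrite [RHS]integral_mkcond; apply: eq_integral => x _.
  rewrite patchE mem_setE/= in_itv/= andbT; have [ax|xa] := ltP a x; last first.
    apply: integral0_eq => y _; rewrite indicE memNset ?mul0r//= => /andP[].
    by rewrite ltNge xa.
  rewrite /chisq_pdf_tail /chisq_tail -ge0_integralZl//; last 3 first.
  - by apply: measurable_funTS; apply/measurable_EFinP; exact: measurable_chisq_pdf.
  - by move=> y _; rewrite lee_fin chisq_pdf_ge0.
  - by rewrite lee_fin chisq_pdf_ge0.
  rewrite [RHS]integral_mkcond; apply: eq_integral => y _.
  rewrite patchE mem_setE/= in_itv/= andbT ltrBlDl indicE.
  have -> : ((x, y) \in C) = (b < x + y)%R by apply/idP/idP; rewrite inE /C/= ax.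
  by case: ifP => _; rewrite ?mul1r ?mul0r.
have -> : `]a, +oo[%classic = `]b, +oo[ `|` `]a, b] :> set R.
  apply/seteqP; split => x /=; rewrite !in_itv/= !andbT.
    by move=> ax; case: (ltP b x) => bx; [left|right; rewrite ax].
  by move=> [/(le_lt_trans ab)//|/andP[]].
rewrite ge0_integral_setU//; first last.
- apply/disj_setPS => x [/=]; rewrite !in_itv/= andbT => bx /andP[_].
  by rewrite leNgt bx.
- by move=> x _; exact: chisq_pdf_tail_ge0.
- exact: measurable_chisq_pdf_tail.
(* For x > b the threshold b - x is negative, so the tail factor is 1 and only the density of the
   first block remains. *)
congr (_ + _); apply: eq_integral => x; rewrite inE/= in_itv/= andbT => bx.
by rewrite /chisq_pdf_tail chisq_tail_le0 ?mule1// subr_le0 ltW.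
Qed.

End decomposition.

(** * Pointwise bounds on the integrand and the theorem *)

Lemma Gamma_half_gt0 {R : realType} m : (1 <= m)%N -> 0 < Gamma (m%:R / 2 : R).
Proof.
move=> m1; have := chi2_norm_seq_gt0 (@chi2_norm_seq_mass R) m1.
by rewrite chi2_mass_Gamma// pmulr_rgt0// powR_gt0.
Qed.

(** The constant K of the theorem, with m = N1, n = I2 and b = r2^2. *)
Definition tail_const {R : realType} (m n : nat) (b : R) : R :=
  expR (- (b - n%:R) / 2) /
  (powR 2 (m%:R / 2) * Num.sqrt pi * powR n%:R ((n%:R - 1) / 2) * Gamma (m%:R / 2)).

Lemma tail_const_ge0 {R : realType} m n (b : R) : (1 <= m)%N -> 0 <= tail_const m n b.
Proof.
move=> m1; rewrite divr_ge0 ?expR_ge0// !mulr_ge0 ?powR_ge0 ?sqrtr_ge0//.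
by rewrite ltW// Gamma_half_gt0.
Qed.

(** The factor e^(-x/2) of the density and the factor e^(-(b-x-n)/2) of the tail bound multiply to
    e^(-(b-n)/2), free of x, so the exponentials join the constant and only powers remain under the
    integral. The same happens in [chisq_pdf_tail_le]. *)
Lemma chisq_pdf_tail_ge {R : realType} m n (b x : R) : (1 <= m)%N -> (2 <= n)%N ->
  0 < x -> x <= b ->
  ((Num.sqrt pi * tail_const m n b / 2 *
    (powR (b - x) (n%:R / 2 - 1) * powR x (m%:R / 2 - 1)))%:E <= chisq_pdf_tail m n b x)%E.
Proof.
move=> m1 n2 x0 xb; have bx0 : 0 <= b - x by lra.
have G0 := @Gamma_half_gt0 R m m1.
have s0 : 0 < Num.sqrt pi :> R by rewrite sqrtr_gt0 pi_gt0.
have D0 : 0 < powR 2 (m%:R / 2) :> R by rewrite powR_gt0.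
have k0 : 0 < powR n%:R ((n%:R - 1) / 2) :> R by rewrite powR_gt0// ltr0n ltnW.
apply: (@le_trans _ _ ((chisq_pdf m x)%:E * _)%E); last first.
  apply: lee_wpmul2l; first by rewrite lee_fin chisq_pdf_ge0.
  exact: chisq_tail_ge.
rewrite -EFinM lee_fin /tail_const /chisq_pdf x0 le_eqVlt; apply/orP; left; apply/eqP.
have -> : expR (- (b - n%:R) / 2) = expR (- x / 2) * expR (- (b - x - n%:R) / 2).
  by rewrite -expRD; congr expR; field.
by field; do ?[apply/andP; split]; lra.
Qed.

Lemma chisq_pdf_tail_le {R : realType} m n (b x : R) : (1 <= m)%N -> (2 <= n)%N ->
  0 < x -> n%:R - 2 < b - x ->
  (chisq_pdf_tail m n b x <= (tail_const m n b *
    (powR x (m%:R / 2 - 1) * powR (b - x) (n%:R / 2) / (b - n%:R + 2 - x)))%:E)%E.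
Proof.
move=> m1 n2 x0 xb.
have G0 := @Gamma_half_gt0 R m m1.
have s0 : 0 < Num.sqrt pi :> R by rewrite sqrtr_gt0 pi_gt0.
have D0 : 0 < powR 2 (m%:R / 2) :> R by rewrite powR_gt0.
have k0 : 0 < powR n%:R ((n%:R - 1) / 2) :> R by rewrite powR_gt0// ltr0n ltnW.
apply: (@le_trans _ _ ((chisq_pdf m x)%:E * _)%E).
  apply: lee_wpmul2l; first by rewrite lee_fin chisq_pdf_ge0.
  exact: chisq_tail_le.
rewrite -EFinM lee_fin /tail_const /chisq_pdf x0 le_eqVlt; apply/orP; left; apply/eqP.
have -> : expR (- (b - n%:R) / 2) = expR (- x / 2) * expR (- (b - x - n%:R) / 2).
  by rewrite -expRD; congr expR; field.
by field; do ?[apply/andP; split]; lra.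
Qed.

Theorem theorem2 (d : measure_display) (T : measurableType d) (R : realType)
    (P : probability T R) (z : nat -> {RV P >-> R}) (I1 I2 : nat) (r1 r2 : R) :
  iid_std_normal z -> (1 <= I1)%N -> (2 <= I2)%N -> 0 < r1 -> r1 < r2 ->
  let N1 := I1 in
  let N2 := (I1 + I2)%N in
  let zeta1 := [set w | r1 ^+ 2 < \sum_(j < N1) (z j w) ^+ 2] in
  let zeta2 := [set w | r2 ^+ 2 < \sum_(j < N2) (z j w) ^+ 2] in
  let mu := @lebesgue_measure R in
  let p := (\int[mu]_(t in `](r2 ^+ 2)%R, +oo[) (chisq_pdf I1 t)%:E)%E in
  let K := expR (- (r2 ^+ 2 - I2%:R) / 2) /
           (powR 2 (N1%:R / 2) * Num.sqrt pi * powR I2%:R ((I2%:R - 1) / 2)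
            * Gamma (N1%:R / 2)) in
  let g := fun t : R => powR t (N1%:R / 2 - 1) * powR (r2 ^+ 2 - t) (I2%:R / 2)
                        / (r2 ^+ 2 - I2%:R + 2 - t) in
  let delta_lo := (I2%:R - 2) / r2 ^+ 2 in
  let delta_hi := (r2 ^+ 2 - r1 ^+ 2) / r2 ^+ 2 in
  (p + (Num.sqrt pi * K / 2)%:E *
       \int[mu]_(t in `[(r1 ^+ 2)%R, (r2 ^+ 2)%R])
          (powR (r2 ^+ 2 - t) (I2%:R / 2 - 1) * powR t (I1%:R / 2 - 1))%R%:E
     <= P (zeta1 `&` zeta2))%E /\
  (P (zeta1 `&` zeta2) <=
     p + ereal_inf
       [set (K%:E * \int[mu]_(t in `[(r1 ^+ 2)%R, ((1 - delta) * r2 ^+ 2)%R]) (g t)%:E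
             + \int[mu]_(t in `[((1 - delta) * r2 ^+ 2)%R, (r2 ^+ 2)%R]) (chisq_pdf I1 t)%:E)%E
        | delta in `]delta_lo, delta_hi[])%E.
Proof.
move=> iid I1_1 I2_2 r1_0 r12 N1 N2 zeta1 zeta2 mu p K g delta_lo delta_hi.
have I2_1 := ltnW I2_2.
have r1r2 : r1 ^+ 2 <= r2 ^+ 2.
  by rewrite ler_pXn2r ?nnegrE ?ltW// (lt_trans r1_0).
have r1_2 : 0 < r1 ^+ 2 by rewrite exprn_gt0.
pose H : R -> \bar R := chisq_pdf_tail I1 I2 (r2 ^+ 2).
have H0 x : (0 <= H x)%E by exact: chisq_pdf_tail_ge0.
have mH D : measurable_fun D H by exact: measurable_chisq_pdf_tail.
have -> : P (zeta1 `&` zeta2) =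
    (p + \int[@lebesgue_measure R]_(t in `](r1 ^+ 2)%R, (r2 ^+ 2)%R]) H t)%E.
  rewrite -(prob_sqsum_gt iid I1_1 I2_1 r1r2); congr (P _); apply/seteqP.
  by split => w /=; rewrite /zeta1 /zeta2 /N1 /N2 /sqsum /= big_split_ord/=.
have K0 : 0 <= K := tail_const_ge0 I2 (r2 ^+ 2) I1_1.
have mpow (q c : R) : measurable_fun setT (fun t : R => powR (c - t) q).
  by apply: (measurableT_comp (measurable_powR _)); exact: measurable_funB.
split.
  have mphi (D : set R) : measurable_fun D (fun t : R =>
      (powR (r2 ^+ 2 - t) (I2%:R / 2 - 1) * powR t (I1%:R / 2 - 1))%:E).
    by apply: measurable_funTS; apply/measurable_EFinP; apply: measurable_funM.
  have c0 : (0 <= (Num.sqrt pi * K / 2)%:E)%E.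
    by rewrite lee_fin divr_ge0// mulr_ge0// sqrtr_ge0.
  apply: leeD2l; rewrite -integral_itv_obnd_cbnd; last exact: mphi.
  rewrite -ge0_integralZl//; last 2 first.
  - exact: mphi.
  - by move=> t _; rewrite lee_fin mulr_ge0 ?powR_ge0.
  apply: ge0_le_integral => //.
  - by move=> t _; rewrite mule_ge0// lee_fin mulr_ge0 ?powR_ge0.
  - by apply: measurable_funeM; exact: mphi.
  - exact: mH.
  move=> t /=; rewrite in_itv/= => /andP[r1t tr2]; rewrite -EFinM.
  by apply: chisq_pdf_tail_ge => //; rewrite (lt_trans r1_2).
(* The bound is proved for each delta separately; if no delta is admissible, the infimum is +oo and
   nothing is left to prove. *)
apply: leeD2l; apply: le_ereal_inf_tmp => x [delta].
rewrite /= in_itv/= => /andP[lo hi] <-{x}.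
have r2_2 : 0 < r2 ^+ 2 by exact: lt_le_trans r1r2.
(* With b = (1 - delta) r2^2, [lo] says r2^2 - b > I2 - 2, so for all t <= b the upper tail bound
   applies and the denominator of [g] is positive; [hi] says r1^2 < b. As I2 >= 2, [lo] also gives b
   < r2^2. *)
rewrite /delta_lo ltr_pdivrMr// in lo; rewrite /delta_hi ltr_pdivlMr// in hi.
have I22 : 2 <= I2%:R :> R by rewrite ler_nat.
set b := (1 - delta) * r2 ^+ 2.
have bE : b = r2 ^+ 2 - delta * r2 ^+ 2 by rewrite /b mulrBl mul1r.
have r1b : r1 ^+ 2 < b by rewrite bE; lra.
have br2 : b < r2 ^+ 2 by rewrite bE; lra.
have -> : `](r1 ^+ 2)%R, (r2 ^+ 2)%R]%classic =
    `](r1 ^+ 2)%R, b] `|` `]b, (r2 ^+ 2)%R] :> set R.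
  apply/seteqP; split => t /=; rewrite !in_itv/=.
    by move=> /andP[-> ->]; rewrite andbT; case: leP; [left|right].
  move=> [/andP[-> tb]|/andP[bt ->]]; rewrite ?andbT.
    exact/ltW/(le_lt_trans tb).
  exact: lt_trans bt.
rewrite ge0_integral_setU//; first last.
- apply/disj_setPS => t [/=]; rewrite !in_itv/= => /andP[_ tb] /andP[].
  by rewrite ltNge tb.
- exact: mH.
apply: leeD; last first.
  rewrite -integral_itv_obnd_cbnd; last first.
    by apply: measurable_funTS; apply/measurable_EFinP; exact: measurable_chisq_pdf.
  apply: ge0_le_integral => //.
  - exact: mH.
  - by apply: measurable_funTS; apply/measurable_EFinP; exact: measurable_chisq_pdf.
  move=> t _; rewrite /H /chisq_pdf_tail -[leRHS]mule1.
  by apply: lee_wpmul2l; [rewrite lee_fin chisq_pdf_ge0|exact: chisq_tail_le1].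
have den t : t <= b -> 0 < r2 ^+ 2 - I2%:R + 2 - t by rewrite bE; lra.
have g0 t : t <= b -> 0 <= g t.
  by move=> tb; rewrite divr_ge0 ?mulr_ge0 ?powR_ge0// ltW// den.
have mg : measurable_fun (`](r1 ^+ 2)%R, b] : set R) (EFin \o g).
  apply/measurable_EFinP.
  (* The inverse is written as a power -1, a measurable function that agrees with it where the
     denominator is positive, in particular for t <= b. *)
  pose g' t : R := powR t (N1%:R / 2 - 1) * powR (r2 ^+ 2 - t) (I2%:R / 2) *
    powR (r2 ^+ 2 - I2%:R + 2 - t) (-1).
  apply: (eq_measurable_fun g').
    move=> t; rewrite inE/= in_itv/= => /andP[_ tb].
    by rewrite /g' powR_inv1// ltW// den.
  by apply: measurable_funTS; apply: measurable_funM => //; apply: measurable_funM.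
rewrite -integral_itv_obnd_cbnd; last exact: mg.
rewrite -ge0_integralZl//; last first.
  by move=> t /=; rewrite in_itv/= => /andP[_ tb]; rewrite lee_fin g0.
apply: ge0_le_integral => //.
- exact: mH.
- by apply: measurable_funeM; exact: mg.
move=> t /=; rewrite in_itv/= => /andP[r1t tb]; rewrite -EFinM.
by apply: chisq_pdf_tail_le => //; [exact: lt_trans r1t|move: tb; rewrite bE; lra].
Qed.
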